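(* Let $s>2$ be an integer and, for $\lambda\in[0,1]$, let $\xi(x)=\lambda x^2+(1-\lambda)x^s$. Then the spherical spin glass model with mixture $\xi$ is, at zero temperature, (i) 1-RSB when $\lambda\in[0,\bar\lambda_{1\to 1F})$; (ii) 1-FRSB when $\lambda\in[\bar\lambda_{1\to 1F},\bar\lambda_{1F\to F})$; (iii) FRSB when $\lambda\in[\bar\lambda_{1F\to F},1)$; (iv) RS when $\lambda=1$.
   Context: Parisi measure at zero temperature. The spherical model with mixture $\xi$ is the centered Gaussian field $H_N$ on $S_N=\{\sigma\in\mathbb R^N:\sum_i\sigma_i^2=N\}$ with covariance $\mathbb E H_N(\sigma^1)H_N(\sigma^2)=N\xi\big(\tfrac1N\sum_i\sigma^1_i\sigma^2_i\big)$. Let $\mathcal K$ be the set of measures on $[0,1]$ of the form $\nu(dx)=\mathbf 1_{[0,1)}(x)\gamma(x)\,dx+\Delta_0\,\delta_{\{1\}}(dx)$, with $\gamma$ nonnegative, right-continuous and nondecreasing on $[0,1)$ and $\Delta_0>0$. For $\nu\in\mathcal K$ put $$\mathcal Q(\nu)=\frac12\Big(\int_0^1\xi'(x)\,\nu(dx)+\int_0^1\frac{dx}{\nu((x,1])}\Big).$$ The functional $\mathcal Q$ has a unique minimizer $\nu_P(dx)=\gamma_P(x)\mathbf 1_{[0,1)}(x)dx+\Delta_P\delta_{\{1\}}(dx)$ in $\mathcal K$ (and $\lim_N N^{-1}\max_{S_N}H_N=\inf_{\mathcal K}\mathcal Q$ a.s.); it is called the Parisi measure at zero temperature. Let $\rho_P$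 be the measure on $[0,1)$ with $\rho_P([0,x])=\gamma_P(x)$ for all $x\in[0,1)$. Terminology (all at zero temperature). - $k$-RSB ($k\ge 0$): the support of $\rho_P$ consists of exactly $k$ points of $[0,1)$ (so together with the point $1$ there are $k+1$ points). RS means $0$-RSB, i.e. $\rho_P=0$. - FRSB: $\rho_P$ is absolutely continuous on $[0,1)$ and $\rho_P([0,1))>0$. - 1-FRSB: there exist $q>0$, $m\in(0,1)$ and a strictly increasing function $w$ such that either $\nu_P(dx)=m\mathbf 1_{[0,q)}(x)dx+w(x)\mathbf 1_{[q,1)}(x)dx+\Delta_P\delta_{\{1\}}(dx)$, or $\nu_P(dx)=w(x)\mathbf 1_{[0,q)}(x)dx+m\mathbf 1_{[q,1)}(x)dx+\Delta_P\delta_{\{1\}}(dx)$. Constants. For given $\lambda\in[0,1)$, let $z=z(\lambda)>0$ be the unique solution of $$\frac1{\xi'(1)}=\frac{1+z}{z^2}\log(1+z)-\frac1z ,$$ and set $z=0$ for $\lambda=1$ (where $\xi'(1)=2$; the right side tends to $1/2$ as $z\to0$). Define $$\bar\lambda_{1\to 1F}=\inf\{\lambda\in[0,1]: 2\lambda z\ge s(1-\lambda)\},\qquad \bar\lambda_{1F\to F}=\frac{s^2(s-1)}{(s-2)(s^2+s+6)}.$$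
   Formalization: In the definition of 1-FRSB the plateau height m is only required to be positive, not in (0,1): with m<1 part (ii) is false, e.g. for s=20 at λ = λ̄_{1→1F} ≈ 0.161 the Parisi density is constant, about 1.73. *)

(* Defs.v *)
From HB Require Import structures.
From mathcomp Require Import all_boot all_order all_algebra.
From mathcomp Require Import all_classical all_reals all_analysis.

Set Implicit Arguments.
Unset Strict Implicit.
Unset Printing Implicit Defensive.

Import Order.TTheory GRing.Theory Num.Theory.
Import numFieldNormedType.Exports.

Local Open Scope classical_set_scope.
Local Open Scope ring_scope.

Notation borel_measure R := {measure set (measurableTypeR R) -> \bar R}.

Definition dens_measure (R : realType) (g : R -> R) (Delta : R)
    (A : set (measurableTypeR R)) : \bar R :=
  (\int[lebesgue_measure]_(x in (A `&` `[0%R, 1%R[)) (g x)%:E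
   + Delta%:E * \d_(1%R : measurableTypeR R) A)%E.

Definition same_measure (R : realType)
    (mu nu : set (measurableTypeR R) -> \bar R) : Prop :=
  forall A : set (measurableTypeR R), measurable A -> mu A = nu A.

Definition admissible_density (R : realType) (gamma : R -> R) : Prop :=
  [/\ forall x : R, x \in `[0, 1[ -> 0 <= gamma x,
      {in `[0, 1[ &, {homo gamma : x y / x <= y}} &
      forall x : R, x \in `[0, 1[ -> gamma y @[y --> x^'+] --> gamma x].

Definition has_form (R : realType) (nu : borel_measure R)
    (gamma : R -> R) (Delta : R) : Prop :=
  [/\ admissible_density gamma, 0 < Delta &
      same_measure nu (dens_measure gamma Delta)].

(* The class K; its elements are Borel measures on the line concentrated on
   [0, 1]. The total mass may be infinite when gamma is not integrable at 1;
   then PQ xi nu = +oo for xi' positive near 1. *)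
Definition in_K (R : realType) (nu : borel_measure R) : Prop :=
  exists gamma Delta, has_form nu gamma Delta.

Definition upper_mass (R : realType) (nu : borel_measure R) (x : R) : \bar R :=
  nu `]x, 1]%classic.

(* The functional Q, with values in the extended reals. The inverse is the one
   of \bar R (with +oo^-1 = 0); the integrand of the second integral is
   degenerate only at the Lebesgue-null point x = 1. *)
Definition PQ (R : realType) (xi : R -> R) (nu : borel_measure R) : \bar R :=
  ((2^-1)%:E *
   (\int[nu]_(x in `[0%R, 1%R]) (derive1 xi x)%:E
    + \int[lebesgue_measure]_(x in `[0%R, 1%R])
        (upper_mass nu x)^-1))%E.

Definition minimizer (R : realType) (xi : R -> R) (nu : borel_measure R) :
    Prop :=
  in_K nu /\ forall mu : borel_measure R, in_K mu -> (PQ xi nu <= PQ xi mu)%E.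

Definition is_parisi_measure (R : realType) (xi : R -> R)
    (nu : borel_measure R) : Prop :=
  minimizer xi nu /\
  forall mu : borel_measure R, minimizer xi mu -> same_measure mu nu.

Definition has_cdf (R : realType) (rho : borel_measure R) (gamma : R -> R) :
    Prop :=
  rho (~` `[0, 1[%classic) = 0%E /\
  forall x : R, x \in `[0, 1[ -> rho `[0, x]%classic = (gamma x)%:E.

Definition parisi_data (R : realType) (xi : R -> R) (nu : borel_measure R)
    (gamma : R -> R) (Delta : R) (rho : borel_measure R) : Prop :=
  [/\ is_parisi_measure xi nu, has_form nu gamma Delta & has_cdf rho gamma].

(* Support of rho relative to [0, 1): the endpoint 1 is never counted. *)
Definition msupport01 (R : realType) (rho : borel_measure R) : set R :=
  [set x | (x \in `[0, 1[) /\
           forall U : set R, open U -> U x -> (0 < rho U)%E].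

Definition kRSB (R : realType) (k : nat) (xi : R -> R) : Prop :=
  exists nu gamma Delta rho, parisi_data xi nu gamma Delta rho /\
    (msupport01 rho #= `I_k)%card.

(* Since rho vanishes outside [0, 1), domination by Lebesgue measure on the
   line is the same as on [0, 1). *)
Definition FRSB (R : realType) (xi : R -> R) : Prop :=
  exists nu gamma Delta rho, parisi_data xi nu gamma Delta rho /\
    rho `<< (@lebesgue_measure R) /\ (0 < rho `[0%R, 1%R[%classic)%E.

Definition strictly_increasing01 (R : realType) (w : R -> R) : Prop :=
  {in `[0, 1[ &, {homo w : x y / x < y}}.

(* The plateau height m ranges over all positive reals, although the usual
   wording is "m in (0, 1)", as for distribution functions at positive
   temperature. At zero temperature gamma is not bounded by 1, and plateaus
   higher than 1 do occur: for lambda x^2 + (1 - lambda) x^6 at the 1-RSB/1-FRSB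
   threshold lambda = 0.343.. the Parisi measure has gamma = 1.027.. on [0, 1).
   There is no upper bound on q. *)
Definition one_FRSB (R : realType) (xi : R -> R) : Prop :=
  exists nu gamma Delta rho, parisi_data xi nu gamma Delta rho /\
    exists (q m : R) (w : R -> R), [/\ 0 < q, 0 < m, strictly_increasing01 w &
      same_measure nu (dens_measure
        (fun x => m * \1_(`[0, q[) x + w x * \1_(`[q, 1[) x) Delta) \/
      same_measure nu (dens_measure
        (fun x => w x * \1_(`[0, q[) x + m * \1_(`[q, 1[) x) Delta)].

Definition mixture (R : realType) (s : nat) (lambda : R) : R -> R :=
  fun x => lambda * x ^+ 2 + (1 - lambda) * x ^+ s.

Definition zeta (R : realType) (s : nat) (lambda : R) : R :=
  if lambda == 1 then 0 else
  xget 0 [set z : R | 0 < z /\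
    (derive1 (mixture s lambda) 1)^-1 = (1 + z) / z ^+ 2 * ln (1 + z) - z^-1].

Definition lambda_1_1F (R : realType) (s : nat) : R :=
  inf [set l : R | 0 <= l <= 1 /\ 2 * l * zeta s l >= s%:R * (1 - l)].

Definition lambda_1F_F (R : realType) (s : nat) : R :=
  s%:R ^+ 2 * (s%:R - 1) / ((s%:R - 2) * (s%:R ^+ 2 + s%:R + 6)).

(* Main.v *)
From HB Require Import structures.
From mathcomp Require Import all_boot all_order all_algebra.
From mathcomp Require Import all_classical all_reals all_analysis.
From mathcomp Require Import measurable_realfun ring lra.
Require Import Defs.

(** Put f = xi'' and, for nu in K, let phi(x) = nu(]x, 1]) be its profile, a
concave nonincreasing function with slope - gamma and final value Delta. As xi'
is the primitive of f vanishing at 0, Tonelli turns the functional into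
2 Q(nu) = int_0^1 (f phi + 1 / phi). For two profiles phi and psi,

  f phi + 1 / phi = f psi + 1 / psi + h (phi - psi)
                    + (phi - psi)^2 / (phi psi^2)   with  h = f - 1 / psi^2,

so psi is the unique minimizer as soon as int h (phi - psi) >= 0 for every
profile phi. This is certified ([parisi_criterion]) when, for some u in [0, 1],
psi = f^(-1/2) on [0, u[ (there h = 0), psi is affine on [u, 1[, the integrals
of h and of h (1 - x) over [u, 1[ vanish, and h is nonpositive, nonnegative,
nonpositive on the three intervals that two points p <= q cut out of [u, 1[.
Indeed, let L be the chord of the competitor phi through p and q: by concavity
phi - L has the same three signs, hence h (phi - L) >= 0, while
int h (L - psi) = 0 because L - psi is affine on [u, 1[.

It remains to produce u and the affine part psi(x) = D + m (1 - x). The sign of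
h is that of f psi^2 - 1, whose derivative is psi times a function that
increases and then decreases; the sign pattern of h therefore follows from
h(u) <= 0 alone ([gap_signs]). Explicit primitives turn the two integral
conditions into two equations on (D, m).

- For u = 0 the solution is m = z D, with z = z(lambda), and h(0) <= 0 means
  2 lambda z <= s (1 - lambda) ([linear_certificate]): gamma is constant, which
  is 1-RSB. The inequality holds below the first threshold by definition of an
  infimum.
- For 0 < u < 1 continuity at u and the first equation determine D and m as
  functions of u, and the second one becomes an equation F(u) = 0 between the
  end point 0 and the inflexion point v of f^(-1/2). If F(0) > 0 the solution
  with u = 0 exists; otherwise F(0) <= 0 <= F(v) and the intermediate value
  theorem applies ([tangent_dichotomy]). At a zero of F, the density of the
  curved part at u cannot exceed m ([tangent_slope_le0]), which makes the whole
  density nondecreasing. Below the second threshold v < 1, and both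
  alternatives give a 1-FRSB measure, a constant density being a plateau on
  [0, 1[.
- For u = 1 the profile is f^(-1/2), which is concave on [0, 1] exactly from the
  second threshold on; its slope has a density, which is FRSB.
- For lambda = 1, f = 2 and psi is the constant 2^(-1/2), which is RS. *)

Set Implicit Arguments.
Unset Strict Implicit.
Unset Printing Implicit Defensive.
Import Order.TTheory GRing.Theory Num.Theory.
Import numFieldNormedType.Exports.
Local Open Scope classical_set_scope.
Local Open Scope ring_scope.

(** * Measures given by a density and an atom *)

Section Density.
Context {R : realType}.
Variables (f : measurableTypeR R -> \bar R) (mf : measurable_fun setT f)
  (f0 : forall x, (0 <= f x)%E).

(** The two proofs are arguments so that the measure structure below can be
attached to the bare term [density mf f0]. *)
Definition density (_ : measurable_fun setT f) (_ : forall x, (0 <= f x)%E)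
  (A : set (measurableTypeR R)) : \bar R :=
  (\int[lebesgue_measure]_(x in A) f x)%E.

Let density0 : density mf f0 set0 = 0%E.
Proof. exact: integral_set0. Qed.

Let density_ge0 A : (0 <= density mf f0 A)%E.
Proof. exact: integral_ge0. Qed.

Let density_sigma : semi_sigma_additive (density mf f0).
Proof. exact: semi_sigma_additive_nng_induced. Qed.

HB.instance Definition _ := isMeasure.Build _ _ _ (density mf f0)
  density0 density_ge0 density_sigma.
End Density.

(** All the measures of the proof have this form: the candidates nu (atom at 1)
and the measures rho with a prescribed distribution function (atom at 0, or at
the jump of the density). *)
Lemma density_atom_measure (R : realType) (D : set R) (g : R -> R) (c p : R) :
  measurable D -> measurable_fun D g -> (forall x, D x -> 0 <= g x) -> 0 <= c ->
  exists mu : borel_measure R, forall A : set (measurableTypeR R),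
    measurable A ->
    mu A = (\int[lebesgue_measure]_(x in A `&` D) (g x)%:E
            + c%:E * \d_(p : measurableTypeR R) A)%E.
Proof.
move=> mD mg g0 c0.
pose f := (EFin \o g) \_ D.
have mf : measurable_fun setT f.
  by apply/(measurable_restrictT _ mD); exact/measurable_EFinP.
have f0 x : (0 <= f x)%E.
  by rewrite /f patchE; case: ifPn => // /set_mem Dx; rewrite lee_fin g0.
exists (measure_add (density mf f0)
  (mscale (NngNum c0) (\d_(p : measurableTypeR R)))) => A mA.
by rewrite [LHS]measure_addE; congr (_ + _)%E; rewrite [RHS]integral_mkcondr.
Qed.

Lemma integral_cst_itv (R : realType) (c x y : R) (b0 b1 : bool) : x <= y ->
  (\int[lebesgue_measure]_(t in [set` Interval (BSide b0 x) (BSide b1 y)]) c%:E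
   = (c * (y - x))%:E)%E.
Proof.
move=> xy; rewrite integral_cst; last exact: measurable_itv.
rewrite /= lebesgue_measure_itv/= lte_fin EFinM.
have [_|yx] := ltP x y; first by rewrite EFinB.
have -> : x = y by apply/eqP; rewrite eq_le xy.
by rewrite subrr !mule0.
Qed.

(** * The profile of a measure of the class K *)

(** Preimages of rays are intervals. *)
Lemma nondecreasing01_measurable (R : realType) (g : R -> R) :
  {in `[0, 1[ &, {homo g : x y / x <= y}} ->
  measurable_fun (`[0, 1[ : set R) g.
Proof.
move=> gnd.
apply: (measurability (@RGenCInfty.G R)) => [|/= _ [_] [r] -> <-].
  exact: RGenCInfty.measurableE.
apply: is_interval_measurable => s t/= [s01 fs] [t01 ft] u /andP[su ut].
have u01 : u \in `[0, 1[.
  move: s01 t01; rewrite !in_itv/= => /andP[s0 _] /andP[_ t1].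
  by rewrite (le_trans s0 su) (le_lt_trans ut t1).
split => //; move: fs ft; rewrite /= !in_itv/= !andbT => fs _.
by rewrite (le_trans fs)// gnd.
Qed.

Lemma admissible_measurable (R : realType) (gamma : R -> R) :
  admissible_density gamma -> measurable_fun (`[0, 1[ : set R) gamma.
Proof. by move=> [_ gnd _]; exact: nondecreasing01_measurable. Qed.

Lemma measurable_funV_pos (R : realType) (D : set R) (g : R -> R) :
  measurable_fun D g -> (forall x, D x -> 0 < g x) ->
  measurable_fun D (fun x => (g x)^-1).
Proof.
move=> mg g0; apply: (@eq_measurable_fun _ _ _ _ _ (fun x => (g x) `^ (-1))).
  by move=> x /set_mem Dx; rewrite powR_inv1// ltW// g0.
exact: measurableT_comp (measurable_powR _) mg.
Qed.

(** The last two clauses bound the chords of [phi] by values of its slope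
[- gamma]: this is the form in which concavity is used. The first of the two
includes the end point [y = 1]; in the second, [gamma 1] would be meaningless. *)
Definition profile_of (R : realType) (nu : borel_measure R) (gamma phi : R -> R)
    (Delta : R) : Prop :=
  [/\ forall x : R, 0 <= x < 1 -> nu `]x, 1]%classic = (phi x)%:E,
    phi 1 = Delta,
    forall x y : R, 0 <= x -> x < y -> y <= 1 -> gamma x * (y - x) <= phi x - phi y &
    forall x y : R, 0 <= x -> x < y -> y < 1 -> phi x - phi y <= gamma y * (y - x)].

Section FiniteForm.
Context {R : realType}.
Variables (nu : borel_measure R) (gamma : R -> R) (Delta : R).
Hypothesis form : has_form nu gamma Delta.
Local Notation mu := (@lebesgue_measure R).

Lemma form_itv_lt1 (x y : R) : 0 <= x -> x <= y -> y < 1 ->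
  nu `]x, y]%classic = (\int[mu]_(t in `]x, y]) (gamma t)%:E)%E.
Proof.
move=> x0 xy y1; have [_ _ ->] := form; last exact: measurable_itv.
rewrite /dens_measure diracE memNset ?mule0 ?adde0; last first.
  by rewrite /= in_itv/= leNgt y1 andbF.
congr (integral _ _ _); apply/setIidPl => t /=; rewrite !in_itv/=.
by move=> /andP[xt ty]; rewrite (le_trans x0 (ltW xt)) (le_lt_trans ty y1).
Qed.

Lemma form_itv1 (x : R) : 0 <= x -> x < 1 ->
  nu `]x, 1]%classic = (\int[mu]_(t in `]x, 1%R[) (gamma t)%:E + Delta%:E)%E.
Proof.
move=> x0 x1; have [_ _ ->] := form; last exact: measurable_itv.
rewrite /dens_measure diracE mem_set ?mule1; last first.
  by rewrite /= in_itv/= x1 lexx.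
congr (integral _ _ _ + _)%E; apply/seteqP; split => t /=; rewrite !in_itv/=.
  by move=> [/andP[xt _] /andP[_ ty]]; rewrite xt.
by move=> /andP[xt t1]; rewrite xt t1 ltW//= (le_trans x0 (ltW xt)).
Qed.

Let gamma_mfun (D : set R) : D `<=` `[0, 1[ -> measurable D ->
  measurable_fun D gamma.
Proof.
move=> DS mD; have [adm _ _] := form.
by apply: measurable_funS DS (admissible_measurable adm); exact: measurable_itv.
Qed.

Lemma form_itv_ge (x y : R) : 0 <= x -> x < y -> y < 1 ->
  ((gamma x * (y - x))%:E <= nu `]x, y]%classic)%E.
Proof.
move=> x0 xy y1; rewrite form_itv_lt1 ?(ltW xy)//.
have [[g0 gnd _] _ _] := form.
have x01 : x \in `[0, 1[ by rewrite in_itv/= x0 (lt_trans xy).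
rewrite (_ : (gamma x * (y - x))%:E = \int[mu]_(t in `]x, y]) (gamma x)%:E)%E.
  apply: ge0_le_integral => //.
  - by move=> t _; rewrite lee_fin g0.
  - apply/measurable_EFinP; apply: gamma_mfun; last exact: measurable_itv.
    move=> t /=; rewrite !in_itv/= => /andP[xt ty].
    by rewrite (le_trans x0 (ltW xt)) (le_lt_trans ty).
  - move=> t /=; rewrite in_itv/= => /andP[xt ty]; rewrite lee_fin gnd ?ltW//.
    by rewrite in_itv/= (le_trans x0 (ltW xt)) (le_lt_trans ty).
by rewrite integral_cst_itv// ltW.
Qed.

Lemma form_itv_le (x y : R) : 0 <= x -> x < y -> y < 1 ->
  (nu `]x, y]%classic <= (gamma y * (y - x))%:E)%E.
Proof.
move=> x0 xy y1; rewrite form_itv_lt1 ?(ltW xy)//.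
have [[g0 gnd _] _ _] := form.
have y01 : y \in `[0, 1[ by rewrite in_itv/= y1 (le_trans x0 (ltW xy)).
have xyS t : `]x, y]%classic t -> t \in `[0, 1[.
  rewrite /= in_itv/= => /andP[xt ty].
  by rewrite in_itv/= (le_trans x0 (ltW xt)) (le_lt_trans ty).
rewrite (_ : (gamma y * (y - x))%:E = \int[mu]_(t in `]x, y]) (gamma y)%:E)%E.
  apply: ge0_le_integral => //.
  - by move=> t /xyS t01; rewrite lee_fin g0.
  - apply/measurable_EFinP; apply: gamma_mfun; last exact: measurable_itv.
    move=> t /=; rewrite !in_itv/= => /andP[xt ty].
    by rewrite (le_trans x0 (ltW xt)) (le_lt_trans ty).
  - move=> t /[dup] /xyS t01; rewrite /= in_itv/= => /andP[xt ty].
    by rewrite lee_fin gnd.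
by rewrite integral_cst_itv// ltW.
Qed.

Lemma form_itv1_ge (x : R) : 0 <= x -> x < 1 ->
  ((gamma x * (1 - x) + Delta)%:E <= nu `]x, 1%R]%classic)%E.
Proof.
move=> x0 x1; rewrite form_itv1// EFinD leeD2r//.
have [[g0 gnd _] _ _] := form.
have x01 : x \in `[0, 1[ by rewrite in_itv/= x0.
rewrite (_ : (gamma x * (1 - x))%:E = \int[mu]_(t in `]x, 1%R[) (gamma x)%:E)%E.
  apply: ge0_le_integral => //.
  - by move=> t _; rewrite lee_fin g0.
  - apply/measurable_EFinP; apply: gamma_mfun; last exact: measurable_itv.
    move=> t /=; rewrite !in_itv/= => /andP[xt ty].
    by rewrite (le_trans x0 (ltW xt)).
  - move=> t /=; rewrite in_itv/= => /andP[xt ty]; rewrite lee_fin gnd ?ltW//.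
    by rewrite in_itv/= (le_trans x0 (ltW xt)).
by rewrite integral_cst_itv// ltW.
Qed.

Lemma form_profile : (nu setT < +oo)%E ->
  exists phi : R -> R, profile_of nu gamma phi Delta.
Proof.
move=> nuoo.
have fin A : measurable A -> nu A \is a fin_num.
  move=> mA; rewrite ge0_fin_numE ?measure_ge0//.
  by apply: le_lt_trans nuoo; apply: le_measure; rewrite ?inE.
pose phi x := if x < 1 then fine (nu `]x, 1]%classic) else Delta.
have phiE x : x < 1 -> nu `]x, 1]%classic = (phi x)%:E.
  by move=> x1; rewrite /phi x1 fineK// fin//; exact: measurable_itv.
have split x y : x < y -> y < 1 ->
    nu `]x, y]%classic = (phi x - phi y)%:E.
  move=> xy y1; rewrite EFinB -!phiE ?(lt_trans xy)//.
  have -> : `]x, 1]%classic = `]x, y]%classic `|` `]y, 1]%classic :> set R.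
    by rewrite -(@itv_bndbnd_setU _ _ _ (BRight y))//= bnd_simp ltW.
  rewrite [X in (X - _)%E]measureU; [|exact: measurable_itv|exact: measurable_itv|].
    by rewrite addeK// fin//; exact: measurable_itv.
  apply/seteqP; split => // t [/=]; rewrite !in_itv/= => /andP[_ ty] /andP[yt _].
  by move: (le_lt_trans ty yt); rewrite ltxx.
exists phi; split.
- by move=> x /andP[_ x1]; exact: phiE.
- by rewrite /phi ltxx.
- move=> x y x0 xy; rewrite le_eqVlt => /orP[/eqP y1|y1].
    rewrite y1 in xy *; rewrite {2}/phi ltxx.
    by rewrite lerBrDr -lee_fin -phiE// form_itv1_ge.
  by rewrite -lee_fin -split// form_itv_ge.
- by move=> x y x0 xy y1; rewrite -lee_fin -split// form_itv_le.
Qed.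
End FiniteForm.

(** * The functional in terms of the profile *)

(** Tonelli on the triangle [0 <= t < y <= 1]: integrating a primitive of [k]
against [nu] is integrating [k] against the tails of [nu]. *)
Lemma integral_cumulative (R : realType) (nu : borel_measure R) (k K : R -> R) :
  (nu setT < +oo)%E -> measurable_fun (`[0, 1] : set R) k ->
  (forall x : R, 0 <= x <= 1 -> 0 <= k x) ->
  (forall y : R, 0 <= y <= 1 ->
    (\int[lebesgue_measure]_(t in `[0%R, y[) (k t)%:E = (K y)%:E)%E) ->
  (\int[nu]_(y in `[0%R, 1%R]) (K y)%:E =
   \int[lebesgue_measure]_(t in `[0%R, 1%R]) ((k t)%:E * nu `]t, 1%R]%classic))%E.
Proof.
move=> nuoo mk k0 kK.
have mT : measurable (setT : set (measurableTypeR R)) by exact: measurableT.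
(* Tonelli asks for a sigma-finite measure: [nu] is repackaged as a finite one. *)
pose nuf : {finite_measure set (measurableTypeR R) -> \bar R} :=
  mfrestr mT nuoo.
have nufE A : nuf A = nu A by rewrite /nuf /= /mfrestr /mrestr setIT.
have -> : (\int[nu]_(y in `[0%R, 1%R]) (K y)%:E =
    \int[nuf]_(y in `[0%R, 1%R]) (K y)%:E)%E.
  by apply: eq_measure_integral => A _ _; apply/esym/nufE.
pose kb : R -> R := k \_ `[0, 1]%classic.
have kb0 x : 0 <= kb x.
  rewrite /kb patchE; case: ifPn => // /set_mem /=.
  by rewrite in_itv/=; exact: k0.
have mkb : measurable_fun setT kb.
  have m01 : measurable (`[0, 1]%classic : set R) by exact: measurable_itv.
  by apply/(measurable_restrictT _ m01).
(* The conditions on the pair (y, t), split so that each one is visibly Borel. *)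
pose S : set (measurableTypeR R * measurableTypeR R) :=
  [set z | 0 <= z.2] `&` [set z | 0 < z.1 - z.2] `&` [set z | z.1 <= 1].
have mS : measurable S.
  have m1 : measurable_fun setT
      (fun z : measurableTypeR R * measurableTypeR R => z.1 - z.2).
    by apply: measurable_funB.
  apply: measurableI; first apply: measurableI.
  - rewrite (_ : [set _ | _] = snd @^-1` `[0, +oo[%classic).
      rewrite -[X in measurable X]setTI.
      by apply: measurable_snd => //; exact: measurable_itv.
    by apply/seteqP; split => z /=; rewrite in_itv/= andbT.
  - rewrite (_ : [set _ | _] =
        (fun z : measurableTypeR R * measurableTypeR R => z.1 - z.2)
          @^-1` `]0, +oo[%classic).
      by rewrite -[X in measurable X]setTI; apply: m1 => //; exact: measurable_itv.
    by apply/seteqP; split => z /=; rewrite in_itv/= andbT.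
  - rewrite (_ : [set _ | _] = fst @^-1` `]-oo, 1]%classic).
      rewrite -[X in measurable X]setTI.
      by apply: measurable_fst => //; exact: measurable_itv.
    by apply/seteqP; split => z /=; rewrite in_itv/=.
pose F (z : measurableTypeR R * measurableTypeR R) : \bar R := (kb z.2 * \1_S z)%:E.
have F0 z : (0 <= F z)%E by rewrite lee_fin mulr_ge0.
have mF : measurable_fun setT F.
  apply/measurable_EFinP; apply: measurable_funM; last exact: measurable_indic.
  exact: measurableT_comp mkb _.
have := fubini_tonelli (m1 := nuf) (m2 := @lebesgue_measure R) F mF F0.
have -> : (\int[nuf]_y \int[lebesgue_measure]_t F (y, t) =
    \int[nuf]_(y in `[0%R, 1%R]) (K y)%:E)%E.
  rewrite [RHS]integral_mkcond; apply: eq_integral => y _.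
  rewrite patchE mem_setE in_itv/=; case: ifPn => y01.
    rewrite -kK// [RHS]integral_mkcond; apply: eq_integral => t _.
    rewrite patchE mem_setE in_itv/= /F /kb /= patchE indicE/= mem_setE in_itv/=.
    have -> : ((y, t) \in S) = (0 <= t < y).
      apply/idP/idP => [/set_mem[[/= t0 ty] y1]|/andP[t0 ty]].
        by rewrite t0 -subr_gt0.
      by apply/mem_set; split; [split => //=; rewrite subr_gt0|case/andP: y01].
    have [|_] := boolP (0 <= t < y); last by rewrite mulr0.
    move=> /andP[t0 ty]; rewrite t0 mulr1 ifT//=.
    by case/andP: y01 => _; apply: le_trans; exact: ltW.
  apply: integral0_eq => t _; rewrite /F indicE memNset ?mulr0//.
  move=> [[/= t0 ty] y1]; move/negP: y01; apply.
  by rewrite y1 andbT (le_trans t0)// ltW// -subr_gt0.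
move=> ->; rewrite [RHS]integral_mkcond; apply: eq_integral => t _.
rewrite patchE mem_setE in_itv/=; case: ifPn => t01; last first.
  apply: integral0_eq => y _; rewrite /F /= /kb patchE mem_setE in_itv/=.
  by rewrite (negbTE t01) mul0r.
rewrite -nufE -[X in (_ * X)%E]mul1e -integral_cst; last exact: measurable_itv.
rewrite -ge0_integralZl//; last by rewrite lee_fin k0.
rewrite [RHS]integral_mkcond; apply: eq_integral => y _.
rewrite patchE mem_setE in_itv/= /F /kb /= patchE indicE/= mem_setE in_itv/= t01.
have -> : ((y, t) \in S) = (t < y <= 1).
  apply/idP/idP => [/set_mem[[/= t0 ty] y1]|/andP[ty y1]].
    by rewrite -subr_gt0 ty.
  by apply/mem_set; split; [split => //=; [case/andP: t01|rewrite subr_gt0]|].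
by case: ifPn => _; rewrite ?mulr0// mulr1 mule1.
Qed.

Section Functional.
Context {R : realType}.
Variables (xi f : R -> R).
Local Notation mu := (@lebesgue_measure R).
Hypothesis mf : measurable_fun (`[0, 1] : set R) f.
Hypothesis f0 : forall x : R, 0 <= x <= 1 -> 0 <= f x.
Hypothesis fint : forall y : R, 0 <= y <= 1 ->
  (\int[mu]_(t in `[0%R, y[) (f t)%:E = (derive1 xi y)%:E)%E.

Lemma PQ_profile (nu : borel_measure R) (phi : R -> R) :
  (nu setT < +oo)%E -> measurable_fun (`[0, 1[ : set R) phi ->
  (forall x, 0 <= x < 1 -> nu `]x, 1]%classic = (phi x)%:E) ->
  (forall x, 0 <= x < 1 -> 0 < phi x) ->
  PQ xi nu =
    ((2^-1)%:E * \int[mu]_(x in `[0%R, 1%R[) (f x * phi x + (phi x)^-1)%:E)%E.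
Proof.
move=> nuoo mphi nuE phi0; rewrite /PQ (integral_cumulative nuoo mf f0 fint).
have mV : measurable_fun (`[0, 1[ : set R) (fun x => (phi x)^-1).
  by apply: measurable_funV_pos mphi _ => x; rewrite /= in_itv/=; exact: phi0.
have fS : measurable_fun (`[0, 1[ : set R) f.
  apply: measurable_funS mf; first exact: measurable_itv.
  by apply: subset_itvl; rewrite bnd_simp.
have eqf : {in `[0, 1[%classic : set R,
    (fun t => (f t)%:E * nu `]t, 1%R]%classic)%E =1
    (fun t => (f t * phi t)%:E)}.
  by move=> x /set_mem; rewrite /= in_itv/= => x01; rewrite nuE.
have eqV : {in `[0, 1[%classic : set R,
    (fun t => (upper_mass nu t)^-1)%E =1 (fun t => (phi t)^-1%:E)}.
  move=> x /set_mem; rewrite /= in_itv/= => x01.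
  by rewrite /upper_mass nuE// inver gt_eqF// phi0.
rewrite -[X in (_ * (X + _))%E]integral_itv_bndo_bndc; last first.
  apply: (eq_measurable_fun (fun t => (f t * phi t)%:E)).
    by move=> x x01; rewrite eqf.
  apply/measurable_EFinP; exact: measurable_funM.
rewrite -[X in (_ * (_ + X))%E]integral_itv_bndo_bndc; last first.
  apply: (eq_measurable_fun (fun t => (phi t)^-1%:E)).
    by move=> x x01; rewrite eqV.
  exact/measurable_EFinP.
have -> : (\int[mu]_(x in `[0%R, 1%R[) ((f x)%:E * nu `]x, 1%R]%classic) =
    \int[mu]_(x in `[0%R, 1%R[) (f x * phi x)%:E)%E.
  by apply: eq_integral => x x01; rewrite eqf.
have -> : (\int[mu]_(x in `[0%R, 1%R[) (upper_mass nu x)^-1 =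
    \int[mu]_(x in `[0%R, 1%R[) (phi x)^-1%:E)%E.
  by apply: eq_integral => x x01; rewrite eqV.
rewrite -ge0_integralD//.
- move=> x; rewrite /= in_itv/= => /[dup] x01 /andP[x0 /ltW x1].
  by rewrite lee_fin mulr_ge0 ?f0 ?x0 ?x1// ltW// phi0.
- by apply/measurable_EFinP; exact: measurable_funM.
- by move=> x; rewrite /= in_itv/= => x01; rewrite lee_fin invr_ge0 ltW// phi0.
- by apply/measurable_EFinP.
Qed.

Hypothesis mxi1 : measurable_fun (`[0, 1] : set R) (derive1 xi).
Hypothesis xi1_half : 0 < derive1 xi 2^-1.

(** Infinite mass can only accumulate at 1, where [xi'] stays above its positive
value at 1/2. Such measures never compete. *)
Lemma PQ_infinite_mass (nu : borel_measure R) (gamma : R -> R) (Delta : R) :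
  has_form nu gamma Delta -> nu setT = +oo%E -> PQ xi nu = +oo%E.
Proof.
move=> form nuoo; have [[g0 gnd _] D0 nuE] := form.
have h01 : 0 < 2^-1 :> R by rewrite invr_gt0.
have h1 : 2^-1 < 1 :> R by rewrite invf_lt1// ltr1n.
pose A : set (measurableTypeR R) := `[2^-1, 1]%classic.
have mA : measurable A by exact: measurable_itv.
have hitv : 2^-1 \in (`[0, 1[ : interval R) by rewrite in_itv/= h1 ltW.
have nuA : nu A = +oo%E.
  have : nu setT = (nu A + nu (~` A))%E.
    rewrite -measureU//; first by rewrite setUCr.
      exact: measurableC.
    exact: setICr.
  rewrite nuoo.
  have : (nu (~` A) < +oo)%E.
    rewrite nuE; last exact: measurableC.
    rewrite /dens_measure diracE memNset; last first.
      by apply; rewrite /A /= in_itv/= lexx ltW.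
    rewrite mule0 adde0 (_ : _ `&` _ = `[0, 2^-1[%classic); last first.
      apply/seteqP; split => t /=; rewrite /A /= !in_itv/=.
        move=> [/negP + /andP[t0 t1]]; rewrite negb_and -!ltNge t0.
        by case/orP => //; rewrite ltNge (ltW t1).
      move=> /andP[t0 th]; split; last by rewrite t0 (lt_trans th).
      by apply/negP; rewrite negb_and -ltNge th.
    have sub t : `[0, 2^-1[%classic t -> t \in (`[0, 1[ : interval R).
      rewrite /= !in_itv/= => /andP[-> th]; exact: lt_trans th h1.
    apply: (@le_lt_trans _ _ (\int[mu]_(t in `[0%R, 2^-1%R[) (gamma 2^-1)%:E)%E).
      apply: ge0_le_integral => //.
      - by move=> t /sub t01; rewrite lee_fin g0.
      - have [adm _ _] := form; apply/measurable_EFinP.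
        apply: measurable_funS (admissible_measurable adm).
          exact: measurable_itv.
        by move=> t /sub.
      - move=> t /[dup] /sub t01; rewrite /= in_itv/= => /andP[_ /ltW th].
        by rewrite lee_fin gnd.
    by rewrite integral_cst_itv ?ltry// ltW.
  by case: (nu A) => [r||]; case: (nu (~` A)) => [r'||].
have xi1_ge0 x : 0 <= x <= 1 -> 0 <= derive1 xi x.
  move=> x01; rewrite -lee_fin -fint//; apply: integral_ge0 => t /=.
  rewrite in_itv/= => /andP[t0 tx]; rewrite lee_fin f0// t0 (le_trans (ltW tx))//.
  by case/andP: x01.
have xi1_ge x : 2^-1 <= x <= 1 -> derive1 xi 2^-1 <= derive1 xi x.
  move=> /andP[hx x1]; have x0 := le_trans (ltW h01) hx.
  have sub t : `[0, x[%classic t -> 0 <= t <= 1.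
    by rewrite /= in_itv/= => /andP[-> tx]/=; rewrite (le_trans (ltW tx)).
  have hh : 0 <= (2^-1 : R) <= 1 by rewrite !ltW.
  rewrite -lee_fin -!fint ?x0 ?x1//.
  apply: ge0_subset_integral.
  - exact: measurable_itv.
  - exact: measurable_itv.
  - apply/measurable_EFinP; apply: measurable_funS mf; first exact: measurable_itv.
    by move=> t /sub; rewrite /= in_itv.
  - by move=> t /sub t01; rewrite lee_fin f0.
  - by apply: subset_itvl; rewrite bnd_simp.
have mEFin : measurable_fun (`[0, 1]%classic : set (measurableTypeR R))
    (fun x => (derive1 xi x)%:E).
  exact/measurable_EFinP.
have AS : A `<=` `[0, 1]%classic.
  by apply: subset_itvr; rewrite bnd_simp ltW.
have int1 : (\int[nu]_(x in `[0%R, 1%R]) (derive1 xi x)%:E = +oo)%E.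
  apply/eqP; rewrite -leye_eq.
  apply: (@le_trans _ _ (\int[nu]_(x in A) (derive1 xi x)%:E)%E); last first.
    exact: ge0_subset_integral.
  apply: (@le_trans _ _ (\int[nu]_(x in A) (derive1 xi 2^-1)%:E)%E).
    by rewrite integral_cst//= nuA gt0_muley// lte_fin.
  apply: ge0_le_integral => //.
  - by move=> x _; rewrite lee_fin ltW.
  - exact: measurable_funS mEFin.
rewrite /PQ int1 addye ?gt0_muley ?lte_fin//.
rewrite gt_eqF// (@lt_le_trans _ _ 0%E)// integral_ge0// => x _.
by rewrite inve_ge0 measure_ge0.
Qed.
End Functional.

(** * Concavity of profiles *)

Section ProfileFacts.
Context {R : realType}.
Variables (nu : borel_measure R) (gamma phi : R -> R) (Delta : R).
Hypothesis adm : admissible_density gamma.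
Hypothesis prof : profile_of nu gamma phi Delta.

Lemma profile_nonincreasing (x y : R) : 0 <= x -> x <= y -> y <= 1 -> phi y <= phi x.
Proof.
have [g0 _ _] := adm; have [_ _ ge _] := prof.
move=> x0; rewrite le_eqVlt => /predU1P[->//|xy] y1.
rewrite -subr_ge0 (le_trans _ (ge x y x0 xy y1))// mulr_ge0 ?subr_ge0 ?(ltW xy)//.
by rewrite g0// in_itv/= x0 (lt_le_trans xy).
Qed.

Lemma profile_ge (x : R) : 0 <= x <= 1 -> Delta <= phi x.
Proof.
have [_ <- _ _] := prof => /andP[x0 x1].
exact: profile_nonincreasing.
Qed.

Lemma profile_measurable : measurable_fun (`[0, 1[ : set R) phi.
Proof.
rewrite -(opprK phi); apply: measurable_funN.
apply: nondecreasing01_measurable => x y; rewrite !in_itv/= => /andP[x0 _] /andP[_ y1] xy.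
by rewrite lerN2 profile_nonincreasing// ltW.
Qed.

Let tangent_lt (x p : R) : 0 <= x -> x < p -> p < 1 ->
  phi x <= phi p + gamma p * (p - x).
Proof.
by have [_ _ _ le] := prof => x0 xp p1; rewrite addrC -lerBlDr le.
Qed.

Let tangent_gt (p x : R) : 0 <= p -> p < x -> x <= 1 ->
  phi x <= phi p - gamma p * (x - p).
Proof.
by have [_ _ ge _] := prof => p0 px x1; rewrite lerBrDr addrC -lerBrDr ge.
Qed.

(** A concave function lies above its chord through [p] and [q] between these
points and below it outside. When [p = q] the chord degenerates into a tangent
line, and the slope [- gamma] provides one. *)
Lemma concave_chord (h : R -> R) (u p q : R) :
  0 <= u -> u <= p -> p <= q -> q <= 1 ->
  (forall x, u <= x < p -> h x <= 0) ->
  (forall x, p < x < q -> 0 <= h x) ->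
  (forall x, q < x < 1 -> h x <= 0) ->
  exists alpha beta, forall x, u <= x < 1 ->
    0 <= h x * (phi x - (alpha + beta * (1 - x))).
Proof.
move=> u0 up pq q1 h1 h2 h3.
have [pltq|qp] := ltP p q.
  pose s := (phi q - phi p) / (q - p).
  exists (phi p + s * (1 - p)), (- s) => x /andP[ux x1].
  have x0 := le_trans u0 ux; have p0 := le_trans u0 up.
  have qp0 : 0 < q - p by rewrite subr_gt0.
  have pl : p < 1 by exact: lt_le_trans q1.
  set l := phi p + _ + _.
  have El : (q - p) * (phi x - l) =
      (phi x - phi p) * (q - p) - (phi q - phi p) * (x - p).
    by rewrite /l /s; field; rewrite gt_eqF.
  have [xp|px|xp] := ltgtP x p.
  - rewrite mulr_le0 ?h1 ?ux//.
    rewrite -(pmulr_rle0 _ qp0) El.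
    have a1 := tangent_lt x0 xp pl.
    have a2 := tangent_gt p0 pltq q1.
    have xp0 : 0 < p - x by rewrite subr_gt0.
    nra.
  - have [xq|qx|xq] := ltgtP x q.
    + rewrite mulr_ge0 ?h2 ?px ?xq//.
      rewrite -(pmulr_rge0 _ qp0) El.
      have a1 := tangent_lt p0 px x1.
      have a2 := tangent_gt x0 xq q1.
      have px0 : 0 < x - p by rewrite subr_gt0.
      have xq0 : 0 < q - x by rewrite subr_gt0.
      nra.
    + rewrite mulr_le0 ?h3 ?qx//.
      rewrite -(pmulr_rle0 _ qp0) El.
      have a1 := tangent_lt p0 pltq (lt_trans qx x1).
      have a2 := tangent_gt (le_trans p0 pq) qx (ltW x1).
      have qx0 : 0 < x - q by rewrite subr_gt0.
      nra.
    + suff -> : phi x - l = 0 by rewrite mulr0.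
      by apply: (mulfI (lt0r_neq0 qp0)); rewrite El xq; ring.
  - suff -> : phi x - l = 0 by rewrite mulr0.
    by apply: (mulfI (lt0r_neq0 qp0)); rewrite El xp; ring.
have {qp}pq : p = q by apply/eqP; rewrite eq_le pq.
subst q.
(* The tangent is taken at [p], or at [u] when [p = 1], where no tangent exists. *)
suff [c [c0 c1 hc]] : exists c, [/\ u <= c, u < 1 -> c < 1 &
    forall x, u <= x < 1 -> x != c -> h x <= 0].
  exists (phi c - gamma c * (1 - c)), (gamma c) => x /andP[ux x1].
  have {}c1 := c1 (le_lt_trans ux x1).
  have x0 := le_trans u0 ux; have c00 := le_trans u0 c0.
  have [->|xc] := eqVneq x c; first by rewrite subrK subrr mulr0.
  rewrite mulr_le0 ?hc ?ux//.
  case: (ltgtP x c) xc => // [xc|cx] _.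
    by have := tangent_lt x0 xc c1; lra.
  by have := tangent_gt c00 cx (ltW x1); lra.
have [p1|p1] := ltP p 1.
  exists p; split => // x /andP[ux x1]; case: (ltgtP x p) => // xp _.
    by rewrite h1 ?ux.
  by rewrite h3 ?xp.
exists u; split => // x /andP[ux x1] _; rewrite h1// ux.
exact: lt_le_trans p1.
Qed.
End ProfileFacts.

(** * The profile determines the measure *)

Lemma bounded01_integrable (R : realType) (g : R -> R) (M : R) :
  measurable_fun (`[0, 1[ : set R) g -> (forall x, 0 <= x < 1 -> `|g x| <= M) ->
  (@lebesgue_measure R).-integrable `[0, 1[ (EFin \o g).
Proof.
move=> mg gM; apply: measurable_bounded_integrable => //.
- by rewrite /= lebesgue_measure_itv/= lte_fin ltr01 -EFinB ltry.
- exists M; split; first exact: num_real.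
  move=> N MN x; rewrite /= in_itv/= => x01.
  exact: le_trans (gM _ x01) (ltW MN).
Qed.

(** Full measure implies density: every interval contains a good point. *)
Lemma ae_itv_exists (R : realType) (P : R -> Prop) (x y : R) : x < y ->
  {ae @lebesgue_measure R, forall t, P t} -> exists2 t, x < t < y & P t.
Proof.
move=> xy aeP; apply: contrapT => nP.
have : (@lebesgue_measure R).-negligible `]x, y[%classic.
  apply: negligibleS aeP => t /=; rewrite in_itv/= => txy Pt.
  by apply: nP; exists t.
move=> /measure_negligible => /(_ (measurable_itv _)).
rewrite /= lebesgue_measure_itv/= lte_fin xy -EFinB => /eqP.
by rewrite eqe subr_eq0 gt_eqF.
Qed.

(** Almost equal profiles have equal chords between almost all pairs of points.
A chord close to the right of [x] bounds [gamma x] from above by [gamma' y] for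
every [y > x]; right continuity then lets [y] tend to [x]. *)
Lemma profile_density_le (R : realType) (nu nu' : borel_measure R)
    (gamma gamma' phi phi' : R -> R) (Delta Delta' : R) :
  admissible_density gamma -> admissible_density gamma' ->
  profile_of nu gamma phi Delta -> profile_of nu' gamma' phi' Delta' ->
  {ae @lebesgue_measure R, forall t, 0 <= t < 1 -> phi t = phi' t} ->
  forall x, 0 <= x < 1 -> gamma x <= gamma' x.
Proof.
move=> [g0 gnd _] [g0' gnd' grc'] [_ _ ge _] [_ _ _ le'] aeE x /andP[x0 x1].
have gxy y : x < y -> y < 1 -> gamma x <= gamma' y.
  move=> xy y1.
  have xc : x < (x + y) / 2 by lra.
  have cy : (x + y) / 2 < y by lra.
  have [s /andP[xs sc] Es] := ae_itv_exists xc aeE.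
  have [t /andP[ct ty] Et] := ae_itv_exists cy aeE.
  have st := lt_trans sc ct.
  have s0 := le_trans x0 (ltW xs).
  have t1 := lt_trans ty y1; have s1 := lt_trans st t1.
  have t0 := le_trans s0 (ltW st).
  have a1 := ge s t s0 st (ltW t1); have a2 := le' s t s0 st t1.
  rewrite Es ?s0// Et ?t0// in a1.
  have a3 : gamma s <= gamma' t.
    by rewrite -(ler_pM2r (_ : 0 < t - s)) ?subr_gt0// (le_trans a1).
  apply: (@le_trans _ _ (gamma s)).
    by rewrite gnd ?ltW// in_itv/= ?x0 ?s0.
  by rewrite (le_trans a3)// gnd' ?ltW// in_itv/= ?t0 ?y1 ?(le_trans t0 (ltW ty)).
apply: (cvgr_to_ge (grc' x _)); first by rewrite in_itv/= x0.
near=> y; apply: gxy; near: y; first exact: nbhs_right_gt.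
exact: nbhs_right_lt.
Unshelve. all: by end_near. Qed.

(** The densities agree by the previous lemma used in both directions, and the
atoms by comparing the two profiles at one common point. *)
Lemma same_profile_same_form (R : realType) (nu nu' : borel_measure R)
    (gamma gamma' phi phi' : R -> R) (Delta Delta' : R) :
  has_form nu gamma Delta -> has_form nu' gamma' Delta' ->
  profile_of nu gamma phi Delta -> profile_of nu' gamma' phi' Delta' ->
  {ae @lebesgue_measure R, forall t, 0 <= t < 1 -> phi t = phi' t} ->
  same_measure nu nu'.
Proof.
move=> form form' prof prof' aeE.
have [adm _ nuE] := form; have [adm' _ nuE'] := form'.
have gE x : 0 <= x < 1 -> gamma x = gamma' x.
  move=> x01; apply/eqP; rewrite eq_le (profile_density_le adm adm' prof prof')//.
  apply: (profile_density_le adm' adm prof' prof) => //.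
  by apply: negligibleS aeE => t /= nE E; apply: nE => /E ->.
have [t /andP[t0 t1] Et] := ae_itv_exists ltr01 aeE.
have t01 : 0 <= t < 1 by rewrite ltW.
have DE : Delta = Delta'.
  have [nuphi _ _ _] := prof; have [nuphi' _ _ _] := prof'.
  have nut := nuphi t t01; have nut' := nuphi' t t01; move: nut nut'.
  rewrite (form_itv1 form) ?(form_itv1 form') ?(ltW t0)//.
  rewrite (_ : \int[lebesgue_measure]_(x in `]t, 1%R[) (gamma x)%:E =
      \int[lebesgue_measure]_(x in `]t, 1%R[) (gamma' x)%:E)%E; last first.
    apply: eq_integral => x /set_mem; rewrite /= in_itv/= => /andP[tx x1].
    by rewrite gE// x1 ltW// (lt_trans t0).
  rewrite Et//; case: (integral _ _ _) => [r||]//= [rD] [rD'].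
  by apply: (addrI r); rewrite rD.
move=> A mA; rewrite nuE// nuE'// /dens_measure DE; congr (_ + _)%E.
apply: eq_integral => x /set_mem[_]; rewrite /= in_itv/= => x01.
by rewrite gE.
Qed.

(** * A certificate of optimality *)

Section Criterion.
Context {R : realType}.
Variables (xi f : R -> R) (M : R).
Local Notation mu := (@lebesgue_measure R).
Hypothesis mf : measurable_fun (`[0, 1] : set R) f.
Hypothesis f0 : forall x : R, 0 <= x <= 1 -> 0 <= f x.
Hypothesis fM : forall x : R, 0 <= x <= 1 -> f x <= M.
Hypothesis fint : forall y : R, 0 <= y <= 1 ->
  (\int[mu]_(t in `[0%R, y[) (f t)%:E = (derive1 xi y)%:E)%E.
Hypothesis mxi1 : measurable_fun (`[0, 1] : set R) (derive1 xi).
Hypothesis xi1_half : 0 < derive1 xi 2^-1.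

Let mf' : measurable_fun (`[0, 1[ : set R) f.
Proof.
apply: measurable_funS mf; first exact: measurable_itv.
by apply: subset_itvl; rewrite bnd_simp.
Qed.

Let energy (phi : R -> R) (x : R) := f x * phi x + (phi x)^-1.

Lemma energy_integrable (nu : borel_measure R) (gamma phi : R -> R) (Delta : R) :
  admissible_density gamma -> 0 < Delta -> profile_of nu gamma phi Delta ->
  mu.-integrable `[0, 1[ (EFin \o energy phi).
Proof.
move=> adm D0 prof.
have phiD x : 0 <= x < 1 -> Delta <= phi x.
  by move=> /andP[x0 /ltW x1]; apply: (profile_ge adm prof); rewrite x0.
have mphi := profile_measurable adm prof.
apply: (@bounded01_integrable _ _ (M * phi 0 + Delta^-1)).
  apply: measurable_funD; first exact: measurable_funM.
  apply: measurable_funV_pos mphi _ => x; rewrite /= in_itv/= => /phiD.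
  exact: lt_le_trans.
move=> x x01; have /andP[x0 /ltW x1] := x01.
have p0 : 0 < phi x by exact: lt_le_trans D0 (phiD _ x01).
have f0x : 0 <= f x by rewrite f0 ?x0.
rewrite /energy ger0_norm ?addr_ge0 ?mulr_ge0 ?invr_ge0 ?(ltW p0)//.
rewrite lerD//; last by rewrite lef_pV2 ?posrE// phiD.
rewrite ler_pM ?fM ?x0 ?(ltW p0)//.
exact: (profile_nonincreasing adm prof).
Qed.

Variables (nu : borel_measure R) (gamma psi : R -> R) (Delta m u p q : R).
Hypothesis form : has_form nu gamma Delta.
Hypothesis prof : profile_of nu gamma psi Delta.
Hypothesis nuoo : (nu setT < +oo)%E.
Hypotheses (u0 : 0 <= u) (up : u <= p) (pq : p <= q) (q1 : q <= 1).
Hypothesis psi_lin : forall x, u <= x < 1 -> psi x = Delta + m * (1 - x).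
Let h x := f x - (psi x) ^- 2.
Hypothesis h0 : forall x, 0 <= x < u -> f x - (psi x) ^- 2 = 0.
Hypothesis h1 : forall x, u <= x < p -> f x - (psi x) ^- 2 <= 0.
Hypothesis h2 : forall x, p < x < q -> 0 <= f x - (psi x) ^- 2.
Hypothesis h3 : forall x, q < x < 1 -> f x - (psi x) ^- 2 <= 0.
Hypothesis ih0 : (\int[mu]_(x in `[u, 1%R[) (f x - (psi x) ^- 2)%:E = 0)%E.
Hypothesis ih1 :
  (\int[mu]_(x in `[u, 1%R[) ((f x - (psi x) ^- 2) * (1 - x))%:E = 0)%E.

Let adm : admissible_density gamma. Proof. by case: form. Qed.

Let D0 : 0 < Delta. Proof. by case: form. Qed.

Let psiD x : 0 <= x < 1 -> Delta <= psi x.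
Proof. by move=> /andP[x0 /ltW x1]; apply: (profile_ge adm prof); rewrite x0. Qed.

Let psi0 x : 0 <= x < 1 -> 0 < psi x.
Proof. by move=> x01; exact: lt_le_trans D0 (psiD x01). Qed.

Let mpsi : measurable_fun (`[0, 1[ : set R) psi.
Proof. exact: profile_measurable adm prof. Qed.

Let mh : measurable_fun (`[0, 1[ : set R) h.
Proof.
apply: measurable_funB mf' _; apply: measurable_funV_pos.
  by apply: measurable_funX.
by move=> x; rewrite /= in_itv/= => x01; rewrite exprn_gt0// psi0.
Qed.

Let h_le x : 0 <= x < 1 -> `|h x| <= M + Delta ^- 2.
Proof.
move=> x01; have /andP[x0 /ltW x1] := x01.
rewrite (le_trans (ler_normB _ _))// lerD//.
  by rewrite ger0_norm ?f0 ?fM ?x0.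
rewrite ger0_norm ?invr_ge0 ?exprn_ge0 ?(ltW (psi0 _))//.
by rewrite lef_pV2 ?posrE ?exprn_gt0 ?psi0// lerXn2r ?nnegrE ?psiD// ltW// psi0.
Qed.

Let h1x_le x : 0 <= x < 1 -> `|h x * (1 - x)| <= M + Delta ^- 2.
Proof.
move=> x01; have /andP[x0 /ltW x1] := x01.
rewrite normrM -[leRHS]mulr1 ler_pM// ?h_le// ger0_norm ?subr_ge0//.
by rewrite gerBl.
Qed.

Let corr (A B x : R) := if u <= x then h x * (A + B * (1 - x)) else 0.

Let mcorr A B : measurable_fun (`[0, 1[ : set R) (corr A B).
Proof.
apply: (eq_measurable_fun
    (fun x => \1_(`[u, +oo[%classic : set R) x * (h x * (A + B * (1 - x))))).
  move=> x _; rewrite /corr indicE mem_setE in_itv/= andbT.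
  by case: ifP; rewrite ?mul1r ?mul0r.
apply: measurable_funM; first by apply: measurable_indic; exact: measurable_itv.
apply: measurable_funM => //; apply: measurable_funD => //.
by apply: measurable_funM => //; exact: measurable_funB.
Qed.

Let sub_u1 : `[u, 1[%classic `<=` (`[0, 1[%classic : set R).
Proof. by apply: subset_itvr; rewrite bnd_simp. Qed.

Let corr_integrable A B : mu.-integrable `[0, 1[ (EFin \o corr A B).
Proof.
apply: (@bounded01_integrable _ _ ((M + Delta ^- 2) * (`|A| + `|B|))) => //.
move=> x x01; have /andP[x0 /ltW x1] := x01; rewrite /corr; case: ifPn => _.
  rewrite normrM ler_pM ?h_le// (le_trans (ler_normD _ _))// lerD2l//.
  by rewrite normrM -[leRHS]mulr1 ler_pM// ger0_norm ?subr_ge0// gerBl.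
have hb0 := le_trans (normr_ge0 _) (h_le x01).
by rewrite normr0 mulr_ge0// addr_ge0.
Qed.

Let corr_integral A B : (\int[mu]_(x in `[0%R, 1%R[) (corr A B x)%:E = 0)%E.
Proof.
have mu1 : measurable (`[u, 1[%classic : set (measurableTypeR R)).
  exact: measurable_itv.
have m01 : measurable (`[0, 1[%classic : set (measurableTypeR R)).
  exact: measurable_itv.
have ih : mu.-integrable `[u, 1[ (EFin \o h).
  apply: (integrableS m01 mu1) => //.
  exact: (bounded01_integrable mh h_le).
have ihx : mu.-integrable `[u, 1[ (EFin \o (fun x => h x * (1 - x))).
  apply: (integrableS m01 mu1) => //.
  apply: (bounded01_integrable _ h1x_le).
  by apply: measurable_funM => //; exact: measurable_funB.
transitivity (\int[mu]_(x in `[u, 1%R[) (A%:E * (h x)%:E + B%:E * (h x * (1 - x))%:E))%E.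
  rewrite [LHS]integral_mkcond [RHS]integral_mkcond; apply: eq_integral => x _.
  rewrite !patchE !mem_setE !in_itv/= /corr.
  have [ux|xu] := leP u x; last by case: ifP.
  rewrite (le_trans u0 ux)/=; case: ifP => // _.
  by rewrite -!EFinM -EFinD; congr EFin; ring.
rewrite integralD//=; last 2 first.
- exact: (integrableZl mu1 A ih).
- exact: (integrableZl mu1 B ihx).
rewrite integralZl// integralZl//.
by rewrite [X in (A%:E * X + _)%E]ih0 [X in (_ + B%:E * X)%E]ih1 !mule0 adde0.
Qed.

Section Competitor.
Variables (nu' : borel_measure R) (gamma' phi : R -> R) (Delta' : R).
Hypothesis form' : has_form nu' gamma' Delta'.
Hypothesis prof' : profile_of nu' gamma' phi Delta'.
Let adm' : admissible_density gamma'. Proof. by case: form'. Qed.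

Let D0' : 0 < Delta'. Proof. by case: form'. Qed.

Let phi0 x : 0 <= x < 1 -> 0 < phi x.
Proof.
move=> /andP[x0 /ltW x1]; apply: lt_le_trans D0' _.
by apply: (profile_ge adm' prof'); rewrite x0.
Qed.

Local Notation ieng g := (\int[mu]_(x in `[0%R, 1%R[) (energy g x)%:E)%E.

(** The convexity defect [(phi - psi)^2 / (phi psi^2)] is what remains of the
energy difference once the linear part [h (phi - psi)] is replaced with [h]
times an affine function, the difference of the chord of [phi] and of [psi].
This replacement, [corr], integrates to 0. *)
Lemma energy_excess : exists A B, forall x, 0 <= x < 1 ->
  (phi x - psi x) ^+ 2 / (phi x * psi x ^+ 2) <=
  energy phi x - energy psi x - corr A B x.
Proof.
have [al [be hab]] := concave_chord prof' u0 up pq q1 h1 h2 h3.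
exists (al - Delta), (be - m) => x x01.
have p0 := phi0 x01; have s0 := psi0 x01.
rewrite -subr_ge0.
have -> : energy phi x - energy psi x - corr (al - Delta) (be - m) x -
    (phi x - psi x) ^+ 2 / (phi x * psi x ^+ 2) =
    h x * (phi x - psi x) - corr (al - Delta) (be - m) x.
  by rewrite /energy /h; field; rewrite !gt_eqF.
rewrite /corr; case: ifPn => [ux|]; last first.
  by rewrite -ltNge => xu; rewrite /h h0 ?mul0r ?subrr//; case/andP: x01 => ->.
have /andP[_ x1] := x01.
have := hab x; rewrite ux x1 => /(_ isT); rewrite -/(h x) psi_lin ?ux//.
by congr (0 <= _); ring.
Qed.

(** Integrating [energy_excess] gives minimality. Equality forces the nonnegative
defect to vanish almost everywhere, hence uniqueness. *)
Lemma energy_compare :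
  (ieng psi <= ieng phi)%E /\
  ((ieng phi <= ieng psi)%E ->
   {ae mu, forall t, 0 <= t < 1 -> phi t = psi t}).
Proof.
have [A [B hAB]] := energy_excess.
have m01 : measurable (`[0, 1[%classic : set (measurableTypeR R)).
  exact: measurable_itv.
have ipsi := energy_integrable adm D0 prof.
have iphi := energy_integrable adm' D0' prof'.
pose N x := energy phi x - energy psi x - corr A B x.
have N0 x : 0 <= x < 1 -> 0 <= N x.
  move=> x01; apply: le_trans (hAB x x01).
  by rewrite divr_ge0 ?sqr_ge0// mulr_ge0 ?sqr_ge0// ltW// phi0.
have iN : mu.-integrable `[0, 1[ (EFin \o N).
  rewrite (_ : _ \o _ =
    (EFin \o energy phi) \- (EFin \o energy psi) \- (EFin \o corr A B))%E//.
  by apply: integrableB => //; exact: integrableB.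
have EN : (\int[mu]_(x in `[0%R, 1%R[) (N x)%:E = ieng phi - ieng psi)%E.
  transitivity (\int[mu]_(x in `[0%R, 1%R[)
      (((EFin \o energy phi) \- (EFin \o energy psi)) \-
       (EFin \o corr A B)) x)%E; first by [].
  rewrite integralB//; last exact: integrableB.
  by rewrite integralB// [X in (_ - X)%E]corr_integral sube0.
have fphi : ieng phi \is a fin_num by exact: (integrable_fin_num m01 iphi).
have fpsi : ieng psi \is a fin_num by exact: (integrable_fin_num m01 ipsi).
split.
  suff : (0 <= ieng phi - ieng psi)%E by rewrite sube_ge0 ?fphi ?fpsi.
  rewrite -EN; apply: integral_ge0 => x.
  by rewrite /= in_itv/= => x01; rewrite lee_fin N0.
move=> le; have : (\int[mu]_(x in `[0%R, 1%R[) `|(N x)%:E| = 0)%E.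
  apply/eqP; rewrite eq_le integral_ge0// andbT.
  have -> : (\int[mu]_(x in `[0%R, 1%R[) `|(N x)%:E| =
      \int[mu]_(x in `[0%R, 1%R[) (N x)%:E)%E.
    apply: eq_integral => x /set_mem; rewrite /= in_itv/= => x01.
    by rewrite ger0_norm // N0.
  by rewrite EN sube_le0.
move=> /(ae_eq_integral_abs _ m01 (measurable_int _ iN)).
apply: negligibleS => t /= nE E; apply: nE => t01.
have tE : N t = 0 by have := E; rewrite /= in_itv/= => /(_ t01) [].
have := hAB t t01; rewrite -/(N t) tE => le0.
have : (phi t - psi t) ^+ 2 / (phi t * psi t ^+ 2) == 0.
  by rewrite eq_le le0/= divr_ge0 ?sqr_ge0// mulr_ge0 ?sqr_ge0// ltW// phi0.
have den0 : phi t * psi t ^+ 2 != 0.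
  by rewrite gt_eqF// mulr_gt0 ?exprn_gt0 ?phi0 ?psi0.
by rewrite mulf_eq0 invr_eq0 (negbTE den0) orbF expf_eq0/= subr_eq0 => /eqP.
Qed.
End Competitor.

(** The hypotheses on [h = f - psi^-2] are first order conditions: [h] vanishes
where the density varies, and is orthogonal to affine functions where it is
constant. The sign pattern makes them sufficient. *)
Theorem parisi_criterion : is_parisi_measure xi nu.
Proof.
have PQE nu' gamma' Delta' phi : has_form nu' gamma' Delta' ->
    profile_of nu' gamma' phi Delta' -> (nu' setT < +oo)%E ->
    PQ xi nu' = ((2^-1)%:E * \int[mu]_(x in `[0%R, 1%R[) (energy phi x)%:E)%E.
  move=> [adm' D' _] prof' oo'; have [nuE _ _ _] := prof'.
  apply: (PQ_profile mf f0 fint oo' (profile_measurable adm' prof') nuE).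
  move=> x /andP[x0 /ltW x1]; apply: lt_le_trans D' _.
  by apply: (profile_ge adm' prof'); rewrite x0.
have m01 : measurable (`[0, 1[%classic : set (measurableTypeR R)).
  exact: measurable_itv.
have PQnu := PQE _ _ _ _ form prof nuoo.
have fin := integrable_fin_num m01 (energy_integrable adm D0 prof).
have h20 : (0 < (2^-1 : R)%:E)%E by rewrite lte_fin invr_gt0.
have inf nu' gamma' Delta' : has_form nu' gamma' Delta' ->
    ~ (nu' setT < +oo)%E -> PQ xi nu' = +oo%E.
  move=> form' /negP; rewrite -leNgt leye_eq => /eqP.
  exact: (PQ_infinite_mass mf f0 fint mxi1 xi1_half form').
have min : minimizer xi nu.
  split; first by exists gamma, Delta.
  move=> nu' [gamma' [Delta' form']].
  have [oo'|noo] := pselect (nu' setT < +oo)%E; last first.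
    by rewrite (inf _ _ _ form')// leey.
  have [phi prof'] := form_profile form' oo'.
  rewrite PQnu (PQE _ _ _ _ form' prof' oo') lee_pmul2l//.
  by have [] := energy_compare form' prof'.
split=> // nu' [[gamma' [Delta' form']] min'].
have := min' nu; have [inK _] := min => /(_ inK).
have [oo'|noo] := pselect (nu' setT < +oo)%E; last first.
  rewrite (inf _ _ _ form')// PQnu leye_eq => /eqP E.
  have := fin_numM (fin_numE _ : (2^-1 : R)%:E \is a fin_num) fin.
  by rewrite E.
have [phi prof'] := form_profile form' oo'.
rewrite PQnu (PQE _ _ _ _ form' prof' oo') lee_pmul2l// => le.
have [_ /(_ le) aeE] := energy_compare form' prof'.
exact: (same_profile_same_form form' form prof' prof aeE).
Qed.
End Criterion.

(** * Differentiation rules *)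

(** The rules below speak of functions in eta-expanded form, so that
[derive_tac] can read the shape of a function off its body and leave only side
conditions and a final algebraic identity. *)

Section Calculus.
Context {R : realType}.
Implicit Types (f g : R -> R) (x a b : R).

Lemma is_derive_addf f g x a b : is_derive x 1 f a -> is_derive x 1 g b ->
  is_derive x 1 (fun y => f y + g y) (a + b).
Proof. by move=> ? ?; apply: is_deriveD. Qed.

Lemma is_derive_oppf f x a : is_derive x 1 f a ->
  is_derive x 1 (fun y => - f y) (- a).
Proof. by move=> ?; apply: is_deriveN. Qed.

Lemma is_derive_mulf f g x a b : is_derive x 1 f a -> is_derive x 1 g b ->
  is_derive x 1 (fun y => f y * g y) (a * g x + f x * b).
Proof.
move=> ? ?; apply: is_derive_eq.
by rewrite /GRing.scale/= addrC [g x * a]mulrC.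
Qed.

Lemma is_derive_expf f x a n : is_derive x 1 f a ->
  is_derive x 1 (fun y => f y ^+ n) (n%:R * f x ^+ n.-1 * a).
Proof.
move=> fa; elim: n => [|n IHn].
  by rewrite !mul0r; under eq_fun do rewrite expr0; exact: is_derive_cst.
under eq_fun do rewrite exprS.
have -> : n.+1%:R * f x ^+ n.+1.-1 * a =
    a * f x ^+ n + f x * (n%:R * f x ^+ n.-1 * a).
  by case: n {IHn} => [|n]; rewrite ?exprS -?(natr1 n.+1)/=; ring.
exact: is_derive_mulf.
Qed.

Lemma is_derive_invf f x a : f x != 0 -> is_derive x 1 f a ->
  is_derive x 1 (fun y => (f y)^-1) (- (a / f x ^+ 2)).
Proof.
move=> f0 fa; apply: is_derive_eq (is_deriveV f0 fa) _.
by rewrite /GRing.scale/= mulNr mulrC.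
Qed.

Lemma is_derive_lnf f x a : 0 < f x -> is_derive x 1 f a ->
  is_derive x 1 (fun y => ln (f y)) (a / f x).
Proof.
move=> f0 fa; have lnf : is_derive (f x) 1 (@ln R) (f x)^-1.
  by apply: is_derive1_ln; exact: f0.
rewrite mulrC.
by apply: (@is_derive1_comp R (@ln R) f x (f x)^-1 a).
Qed.

Lemma is_derive_sqrtf f x a : 0 < f x -> is_derive x 1 f a ->
  is_derive x 1 (fun y => Num.sqrt (f y)) (a / (2 * Num.sqrt (f x))).
Proof.
move=> f0 fa.
have sqf : is_derive (f x) 1 (@Num.sqrt R) (2 * Num.sqrt (f x))^-1.
  by apply: is_derive1_sqrt; exact: f0.
rewrite mulrC.
by apply: (@is_derive1_comp R (@Num.sqrt R) f x (2 * Num.sqrt (f x))^-1 a).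
Qed.

Lemma is_derive_eqf f x a b : is_derive x 1 f a -> a = b -> is_derive x 1 f b.
Proof. by move=> ? <-. Qed.

Lemma is_derive_cstf x a : is_derive x 1 (fun=> a : R) 0.
Proof. exact: is_derive_cst. Qed.

Lemma is_derive_idf x : is_derive x 1 (fun y : R => y) 1.
Proof. exact: is_derive_id. Qed.

Lemma is_derive_scalef x a : is_derive x 1 ( *%R a) a.
Proof.
apply: (@is_derive_eqf _ _ (0 * x + a * 1)); last by rewrite mul0r add0r mulr1.
exact: (is_derive_mulf (is_derive_cstf x a) (is_derive_idf x)).
Qed.

Lemma is_derive_shiftf x a : is_derive x 1 (+%R a) 1.
Proof.
rewrite -[X in is_derive _ _ _ X]add0r.
exact: (is_derive_addf (is_derive_cstf x a) (is_derive_idf x)).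
Qed.

Lemma is_derive_negf x : is_derive x 1 (-%R : R -> R) (- 1).
Proof. exact: (is_derive_oppf (is_derive_idf x)). Qed.
End Calculus.

Ltac derive_rules := first
  [ notypeclasses refine (is_derive_cstf _ _)
  | notypeclasses refine (is_derive_idf _)
  (* Eta-reduced forms, to which [fun y => a * y] and the like are contracted. *)
  | notypeclasses refine (is_derive_scalef _ _)
  | notypeclasses refine (is_derive_shiftf _ _)
  | notypeclasses refine (is_derive_negf _)
  | lazymatch goal with
    | |- is_derive _ _ (fun y => @?F y + @?G y) _ =>
        notypeclasses refine (is_derive_addf _ _); derive_rules
    | |- is_derive _ _ (fun y => - @?F y) _ =>
        notypeclasses refine (is_derive_oppf _); derive_rules
    | |- is_derive _ _ (fun y => @?F y * @?G y) _ =>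
        notypeclasses refine (is_derive_mulf _ _); derive_rules
    | |- is_derive _ _ (fun y => @?F y ^+ _) _ =>
        notypeclasses refine (is_derive_expf _ _); derive_rules
    | |- is_derive _ _ (fun y => (@?F y)^-1) _ =>
        notypeclasses refine (is_derive_invf _ _); [|derive_rules]
    | |- is_derive _ _ (fun y => ln (@?F y)) _ =>
        notypeclasses refine (is_derive_lnf _ _); [|derive_rules]
    | |- is_derive _ _ (fun y => Num.sqrt (@?F y)) _ =>
        notypeclasses refine (is_derive_sqrtf _ _); [|derive_rules]
    end
  | idtac ].

Ltac derive_tac := notypeclasses refine (is_derive_eqf _ _); [derive_rules|].

(** * Monotonicity and sign patterns *)

Section Monotone.
Context {R : realType}.
Variables (F F' : R -> R) (u v : R).
Hypothesis dF : forall x, u <= x <= v -> is_derive x 1 F (F' x).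

Lemma is_derive_within_continuous : {within `[u, v], continuous F}.
Proof.
apply: continuous_in_subspaceT => x /set_mem; rewrite /= in_itv/= => xuv.
apply/differentiable_continuous/derivable1_diffP.
by have [] := dF xuv.
Qed.

Let derF x : x \in `]u, v[ -> derivable F x 1 /\ derive1 F x = F' x.
Proof.
rewrite in_itv/= => /andP[ux xv].
have xuv : u <= x <= v by rewrite !ltW.
by have [dFx FE] := dF xuv; split => //; rewrite derive1E.
Qed.

Lemma derive_ge0_nondecreasing : (forall x, u < x < v -> 0 <= F' x) ->
  forall x y, u <= x -> x <= y -> y <= v -> F x <= F y.
Proof.
move=> F0; apply: ger0_derive1_ndecr; last exact: is_derive_within_continuous.
  by move=> x /derF[].
by move=> x xuv; have [_ ->] := derF xuv; apply: F0; rewrite in_itv/= in xuv.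
Qed.

Lemma derive_gt0_increasing : (forall x, u < x < v -> 0 < F' x) ->
  forall x y, u <= x -> x < y -> y <= v -> F x < F y.
Proof.
move=> F0 x y ux xy yv.
apply: (@gtr0_derive1_lt_cc _ F u v) => //.
- by move=> z /derF[].
- by move=> z zuv; have [_ ->] := derF zuv; apply: F0; rewrite in_itv/= in zuv.
- exact: is_derive_within_continuous.
- by rewrite in_itv/= ux (le_trans (ltW xy)).
- by rewrite in_itv/= yv (le_trans ux (ltW xy)).
Qed.

Lemma integral_derive : u < v -> {within `[u, v], continuous F'} ->
  (\int[lebesgue_measure]_(x in `[u, v]) (F' x)%:E = (F v - F u)%:E)%E.
Proof.
move=> uv cF'; rewrite EFinB; apply: continuous_FTC2 => //.
- have cF := is_derive_within_continuous.
  have [_ cr cl] := (continuous_within_itvP F uv).1 cF.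
  split=> // x xuv; by have [] := derF xuv.
- by move=> x xuv; have [_ ->] := derF xuv.
Qed.
End Monotone.

Lemma derive_le0_nonincreasing (R : realType) (F F' : R -> R) (u v : R) :
  (forall x, u <= x <= v -> is_derive x 1 F (F' x)) ->
  (forall x, u < x < v -> F' x <= 0) ->
  forall x y, u <= x -> x <= y -> y <= v -> F y <= F x.
Proof.
move=> dF F0 x y ux xy yv; rewrite -lerN2.
apply: (@derive_ge0_nondecreasing _ (fun x => - F x) (fun x => - F' x) u v) => //.
  by move=> z /dF ?; exact: is_derive_oppf.
by move=> z /F0; rewrite oppr_ge0.
Qed.

Section Signs.
Context {R : realType}.
Implicit Types (k : R -> R).

Definition neg_pos_neg k (u p q : R) : Prop :=
  [/\ u <= p <= q /\ q <= 1, forall x, u <= x < p -> k x <= 0,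
      forall x, p < x < q -> 0 <= k x & forall x, q < x <= 1 -> k x <= 0].

Lemma continuous_zero k (x y : R) : {within `[x, y], continuous k} -> x <= y ->
  k x * k y <= 0 -> exists2 z, x <= z <= y & k z = 0.
Proof.
move=> ck xy kxy.
have [|z] := @IVT _ k x y 0 xy ck; last first.
  by rewrite in_itv/=; exists z.
rewrite ge_min le_max.
have [kx|kx] := ltP 0 (k x); have [ky|ky] := ltP 0 (k y).
- by have := mulr_gt0 kx ky; rewrite ltNge kxy.
- by rewrite (ltW kx).
- by rewrite (ltW ky) orbT.
- have /eqP : k x * k y = 0 by apply/eqP; rewrite eq_le kxy mulr_le0.
  by rewrite mulf_eq0 => /orP[] /eqP ->; rewrite lexx ?orbT.
Qed.

(** A function increasing up to [c] and decreasing afterwards has sign pattern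
-,+,-; each sign change is a zero given by the intermediate value theorem, and
any of the three intervals may be empty. *)
Lemma unimodal_signs k (u c : R) : continuous k -> u <= c -> c <= 1 ->
  (forall x y, u <= x -> x <= y -> y <= c -> k x <= k y) ->
  (forall x y, c <= x -> x <= y -> y <= 1 -> k y <= k x) ->
  exists p q, neg_pos_neg k u p q /\ p <= c.
Proof.
move=> ck uc c1 inc dec.
have [kc|kc] := leP (k c) 0.
  exists c, c; split=> //; split.
  - by rewrite uc lexx.
  - by move=> x /andP[ux xc]; apply: le_trans kc; apply: inc => //; exact: ltW.
  - by move=> x /andP[cx /(lt_trans cx)]; rewrite ltxx.
  - by move=> x /andP[cx x1]; apply: le_trans kc; apply: dec => //; exact: ltW.
have [p [up pc kp1 kp2]] : exists p, [/\ u <= p, p <= c,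
    forall x, u <= x < p -> k x <= 0 & forall x, p < x <= c -> 0 <= k x].
  have [ku|ku] := leP 0 (k u).
    exists u; split => // x /andP[ux].
      by move=> /(le_lt_trans ux); rewrite ltxx.
    by move=> xc; apply: le_trans ku _; apply: inc => //; exact: ltW.
  have [|z /andP[uz zc] kz] := continuous_zero (continuous_subspaceT ck) uc; first by nra.
  exists z; split => // x /andP[h1 h2]; rewrite -kz.
    by apply: inc => //; exact: ltW.
  by apply: inc => //; exact: ltW.
have [q [cq q1 kq1 kq2]] : exists q, [/\ c <= q, q <= 1,
    forall x, c <= x < q -> 0 <= k x & forall x, q < x <= 1 -> k x <= 0].
  have [k1|k1] := leP 0 (k 1).
    exists 1; split => // x /andP[cx].
      by move=> x1; apply: le_trans k1 _; apply: dec => //; exact: ltW.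
    by move=> /(lt_le_trans cx); rewrite ltxx.
  have [|z /andP[cz z1] kz] := continuous_zero (continuous_subspaceT ck) c1; first by nra.
  exists z; split => // x /andP[h1 h2]; rewrite -kz.
    by apply: dec => //; exact: ltW.
  by apply: dec => //; exact: ltW.
exists p, q; split=> //; split => //.
  by rewrite up q1 (le_trans pc cq).
move=> x /andP[px xq]; have [xc|cx] := leP x c; first by rewrite kp2 ?px.
by rewrite kq1 ?(ltW cx).
Qed.

(** A primitive of a function of pattern -,+,- decreases, increases, decreases.
Starting from a nonpositive value, it is still nonpositive at [p], and from [p]
on it is unimodal. *)
Lemma primitive_signs (F F' : R -> R) (u p q : R) :
  (forall x : R, is_derive x 1 F (F' x)) -> F u <= 0 -> neg_pos_neg F' u p q ->
  exists p' q', neg_pos_neg F u p' q'.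
Proof.
move=> dF Fu [[/andP[up pq] q1] n1 n2 n3].
have cF : continuous F.
  by move=> x; apply/differentiable_continuous/derivable1_diffP; have [] := dF x.
have dec1 := @derive_le0_nonincreasing _ F F' u p (fun x _ => dF x).
have inc := @derive_ge0_nondecreasing _ F F' p q (fun x _ => dF x).
have dec2 := @derive_le0_nonincreasing _ F F' q 1 (fun x _ => dF x).
have [p' [q' [[[/andP[pp' p'q'] q'1] s1 s2 s3] _]]] :
    exists p' q', neg_pos_neg F p p' q' /\ p' <= q.
  apply: unimodal_signs => //.
    by apply: inc => x /andP[px xq]; rewrite n2 ?px.
  by apply: dec2 => x /andP[qx xq]; rewrite n3 ?qx// ltW.
exists p', q'; split=> //; first by rewrite (le_trans up pp').
move=> x /andP[ux xp']; have [px|xp] := leP p x; first by rewrite s1 ?px.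
apply: le_trans Fu; apply: dec1 => //; last exact: ltW.
by move=> y /andP[uy yp]; rewrite n1 ?(ltW uy).
Qed.

(** When the first interval of the previous pattern is empty and the primitive
starts at 0, it increases and then decreases, so it is positive first. *)
Lemma primitive_signs_pos (F F' : R -> R) (u q : R) : u <= q -> q <= 1 ->
  (forall x : R, is_derive x 1 F (F' x)) -> F u = 0 ->
  (forall x, u < x < q -> 0 <= F' x) -> (forall x, q < x <= 1 -> F' x <= 0) ->
  exists c, [/\ u <= c <= 1, forall x, u <= x < c -> 0 <= F x &
    forall x, c < x <= 1 -> F x <= 0].
Proof.
move=> uq q1 dF Fu n1 n2.
have cF : continuous F.
  by move=> x; apply/differentiable_continuous/derivable1_diffP; have [] := dF x.
have inc := @derive_ge0_nondecreasing _ F F' u q (fun x _ => dF x) n1.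
have dec := @derive_le0_nonincreasing _ F F' q 1 (fun x _ => dF x).
have {}dec : forall x y, q <= x -> x <= y -> y <= 1 -> F y <= F x.
  by apply: dec => x /andP[qx xq]; rewrite n2 ?qx// ltW.
have Fge x : u <= x -> x <= q -> 0 <= F x.
  by move=> ux xq; rewrite -Fu inc.
have [F1|F1] := leP 0 (F 1).
  exists 1; split; first by rewrite lexx (le_trans uq).
    move=> x /andP[ux x1]; have [xq|qx] := leP x q; first exact: Fge.
    by apply: le_trans F1 _; apply: dec => //; exact: ltW.
  by move=> x /andP[cx /(lt_le_trans cx)]; rewrite ltxx.
have [|z /andP[qz z1] Fz] := continuous_zero (continuous_subspaceT cF) q1.
  by have := Fge q uq (lexx q); nra.
exists z; split; first by rewrite z1 (le_trans uq).
  move=> x /andP[ux xz]; have [xq|qx] := leP x q; first exact: Fge.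
  by rewrite -Fz dec// ltW.
by move=> x /andP[zx x1]; rewrite -Fz dec// ltW.
Qed.
End Signs.

(** * Affine profiles *)

Section Line.
Context {R : realType}.
Variables (k : nat) (a b D m : R).

(** [xi''] for the mixture of degree [k + 3], with suitable [a] and [b]. *)
Definition hess x := a + b * x ^+ k.+1.
Local Notation f := hess.

Definition line x := D + m * (1 - x).
Local Notation psi := line.

(** It has the sign of [f - psi^-2] and, unlike it, is a polynomial. *)
Definition gap x := f x * psi x ^+ 2 - 1.
Local Notation P := gap.

(** The derivative of [gap] divided by [line]; at a point where [gap] vanishes
its sign also compares the slopes of [f^(-1/2)] and of [line]. *)
Definition gap_slope x := b * (k%:R + 1) * x ^+ k * psi x - 2 * m * f x.
Local Notation r := gap_slope.

(** The point where [gap_slope] stops increasing, from the factorization of its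
derivative; it may lie beyond 1. *)
Definition peak := k%:R * (D + m) / ((k%:R + 3) * m).
Local Notation xs := peak.

Hypotheses (b0 : 0 < b) (D0 : 0 < D) (m0 : 0 < m).

Lemma line_gt0 x : x <= 1 -> 0 < psi x.
Proof. by move=> x1; rewrite ltr_wpDr// mulr_ge0 ?subr_ge0// ltW. Qed.

Lemma gap_derive (x : R) : is_derive x 1 P (psi x * r x).
Proof.
rewrite /P /f /psi; derive_tac.
by rewrite /r /f /psi /= -(natr1 k); ring.
Qed.

Let r' x := b * (k%:R + 1) * (k%:R * x ^+ k.-1 * psi x - 3 * m * x ^+ k).

Lemma gap_slope_derive (x : R) : is_derive x 1 r (r' x).
Proof.
rewrite /r /f /psi; derive_tac.
by rewrite /r' /psi /= -(natr1 k); ring.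
Qed.

Let k0 : 0 <= k%:R :> R. Proof. exact: ler0n. Qed.

Let den0 : 0 < (k%:R + 3) * m. Proof. by rewrite mulr_gt0//; lra. Qed.

Let r'E x : x * r' x =
  b * (k%:R + 1) * x ^+ k * ((k%:R + 3) * m * (xs - x)).
Proof.
have -> : (k%:R + 3) * m * (xs - x) = k%:R * (D + m) - (k%:R + 3) * m * x.
  by rewrite /xs; field; rewrite !gt_eqF//; lra.
have xk : x * (k%:R * x ^+ k.-1) = k%:R * x ^+ k.
  by case: (k) => [|n]; rewrite ?mul0r ?mulr0// exprS /= mulrCA.
transitivity (b * (k%:R + 1) *
    (x * (k%:R * x ^+ k.-1) * psi x - 3 * m * x * x ^+ k)).
  by rewrite /r'; ring.
by rewrite xk /psi; ring.
Qed.

Let bk0 x : 0 <= x -> 0 <= b * (k%:R + 1) * x ^+ k.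
Proof. by move=> x0; rewrite !mulr_ge0 ?exprn_ge0 ?(ltW b0)//; lra. Qed.

Lemma gap_slope_increasing x y : 0 <= x -> x <= y -> y <= xs -> r x <= r y.
Proof.
move=> x0 xy yxs.
apply: (@derive_ge0_nondecreasing _ r r' 0 xs) => //.
  by move=> z _; exact: gap_slope_derive.
move=> z /andP[z0 zxs]; rewrite -(pmulr_rge0 _ z0) r'E mulr_ge0 ?bk0 ?(ltW z0)//.
by rewrite mulr_ge0 ?(ltW den0)// subr_ge0 ltW.
Qed.

Lemma gap_slope_decreasing x y : 0 <= x -> xs <= x -> x <= y -> r y <= r x.
Proof.
move=> x0 xsx xy.
apply: (@derive_le0_nonincreasing _ r r' x y) => //.
  by move=> z _; exact: gap_slope_derive.
move=> z /andP[xz zy]; have z0 : 0 < z by exact: le_lt_trans xz.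
rewrite -(pmulr_rle0 _ z0) r'E mulr_ge0_le0 ?bk0 ?(ltW z0)//.
by rewrite mulr_ge0_le0 ?(ltW den0)// subr_le0 (le_trans xsx)// ltW.
Qed.

(** The equality [p = u] beyond the peak records that [gap_slope] is then
decreasing on the whole interval. *)
Lemma gap_slope_signs u : 0 <= u <= 1 ->
  exists p q, neg_pos_neg r u p q /\ (xs <= u -> p = u).
Proof.
move=> /andP[u0 u1].
have cr : continuous r.
  move=> x; apply/differentiable_continuous/derivable1_diffP.
  by have [] := gap_slope_derive x.
have [xsu|uxs] := leP xs u.
  have [||p [q [npn pu]]] := unimodal_signs cr (lexx u) u1.
  - move=> x y ux xy yu; have -> : x = y; last exact: lexx.
    by apply/eqP; rewrite eq_le xy (le_trans yu ux).
  - by move=> x y ux xy _; apply: gap_slope_decreasing; rewrite ?(le_trans _ ux).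
  exists p, q; split => // _; apply/eqP; rewrite eq_le pu.
  by have [[/andP[-> _] _] _ _ _] := npn.
have uc : u <= Num.min xs 1 by rewrite le_min u1 ltW.
have c1 : Num.min xs 1 <= 1 by rewrite ge_min lexx orbT.
have [||p [q [npn pu]]] := unimodal_signs cr uc c1.
- move=> x y ux xy; rewrite le_min => /andP[yxs y1].
  by apply: gap_slope_increasing; rewrite ?(le_trans u0 ux).
- move=> x y; rewrite ge_min => /orP[xsx|x1] xy y1.
    by apply: gap_slope_decreasing => //; apply: le_trans xsx; rewrite (le_trans u0)// ltW.
  have -> : x = y; last exact: lexx.
  by apply/eqP; rewrite eq_le xy (le_trans y1 x1).
by exists p, q; split=> // /(lt_le_trans uxs); rewrite ltxx.
Qed.

Lemma gap_signs u : 0 <= u <= 1 -> P u <= 0 ->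
  exists p q, neg_pos_neg P u p q.
Proof.
move=> u01 Pu; have [p [q [[[/andP[up pq] q1] n1 n2 n3] _]]] := gap_slope_signs u01.
apply: (@primitive_signs _ P (fun x => psi x * r x) u p q) => //.
  exact: gap_derive.
have ps x : x <= 1 -> 0 <= psi x by move=> x1; rewrite ltW// line_gt0.
split=> [|x /andP[ux xp]|x /andP[px xq]|x /andP[qx x1]]; first by rewrite up.
- rewrite mulr_ge0_le0 ?n1 ?ux// ps//.
  by rewrite (le_trans (ltW xp))// (le_trans pq).
- by rewrite mulr_ge0 ?n2 ?px// ps// (le_trans (ltW xq)).
- by rewrite mulr_ge0_le0 ?n3 ?qx// ps.
Qed.

(** Pattern +,- instead of -,+,-: this is the situation to be excluded at the
junction of the curved and affine parts. *)
Lemma gap_signs_tangent u : 0 <= u <= 1 -> P u = 0 -> xs <= u \/ 0 < r u ->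
  exists c, [/\ u <= c <= 1, forall x, u <= x < c -> 0 <= P x &
    forall x, c < x <= 1 -> P x <= 0].
Proof.
move=> u01 Pu alt.
have [p [q [[[/andP[up pq] q1] n1 n2 n3] pu]]] := gap_slope_signs u01.
have {}pu : p = u.
  case: alt => [/pu//|ru]; apply/eqP; rewrite eq_le up andbT leNgt; apply/negP => up'.
  by have := n1 u; rewrite lexx up' => /(_ isT); rewrite leNgt ru.
subst p; have ps x : x <= 1 -> 0 <= psi x by move=> x1; rewrite ltW// line_gt0.
apply: (@primitive_signs_pos _ P (fun x => psi x * r x) u q) => //.
- exact: gap_derive.
- move=> x /andP[ux xq]; rewrite mulr_ge0 ?n2 ?ux// ps//.
  by rewrite (le_trans (ltW xq)).
- by move=> x /andP[qx x1]; rewrite mulr_ge0_le0 ?n3 ?qx// ps.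
Qed.

(** Two such points exist, so one of them avoids any given [c]. *)
Lemma gap_gt0_right u c : 0 <= u < 1 -> P u = 0 -> 0 < r u ->
  exists x, [/\ u < x < 1, x != c & 0 < P x].
Proof.
move=> /andP[u0 u1] Pu ru.
have cr : {for u, continuous r}.
  apply/differentiable_continuous/derivable1_diffP.
  by have [] := gap_slope_derive u.
have [e /= e0 re] : exists2 e : R, 0 < e & forall x, u < x < u + e -> 0 < r x.
  have /cvgr_gt/(_ 0 ru) := cr.
  move=> /nbhs_ballP[e /= e0 he]; exists e => // x /andP[ux xe].
  apply: he; rewrite /ball/= ltr_distlC; apply/andP; split; lra.
pose v := u + Num.min e (1 - u).
have e1 : 0 < Num.min e (1 - u) by rewrite lt_min e0 subr_gt0.
have ue : Num.min e (1 - u) <= e by rewrite ge_min lexx.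
have u1' : Num.min e (1 - u) <= 1 - u by rewrite ge_min lexx orbT.
have Pgt x : u < x < v -> 0 < P x.
  move=> /andP[ux xv]; rewrite -Pu.
  apply: (@derive_gt0_increasing _ P (fun x => psi x * r x) u x) => //.
    by move=> z _; exact: gap_derive.
  move=> z /andP[uz zx]; rewrite mulr_gt0 ?line_gt0 ?re//; rewrite /v in xv; [lra|].
  by apply/andP; split; lra.
have [xc|xc] := eqVneq (u + Num.min e (1 - u) / 2) c.
  exists (u + Num.min e (1 - u) / 3); split.
  - by apply/andP; split; lra.
  - by rewrite -xc lt_eqF//; lra.
  - by apply: Pgt; rewrite /v; apply/andP; split; lra.
exists (u + Num.min e (1 - u) / 2); split => //.
- by apply/andP; split; lra.
- by apply: Pgt; rewrite /v; apply/andP; split; lra.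
Qed.

Variables (xi xi1 : R -> R).
Hypothesis dxi : forall x : R, is_derive x 1 xi (xi1 x).
Hypothesis dxi1 : forall x : R, is_derive x 1 xi1 (f x).

Definition residual x := f x - (psi x) ^- 2.
Local Notation h := residual.

(** A primitive of the residual. *)
Definition moment0 x := xi1 x - (m * psi x)^-1.
Local Notation V := moment0.

(** A primitive of the residual times [1 - x]. *)
Definition moment1 x :=
  (1 - x) * xi1 x + xi x + (ln (psi x) + D / psi x) / m ^+ 2.
Local Notation W := moment1.

Lemma residualE x : x <= 1 -> h x = P x / psi x ^+ 2.
Proof. by move=> /line_gt0 p0; rewrite /h /P; field; rewrite gt_eqF. Qed.

Let dpsi (x : R) : is_derive x 1 psi (- m).
Proof. by rewrite /psi; derive_tac; rewrite /=; ring. Qed.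

Lemma moment0_derive (x : R) : x <= 1 -> is_derive x 1 V (h x).
Proof.
move=> x1; have p0 := line_gt0 x1; rewrite /V; derive_tac.
- exact: dxi1.
- by rewrite gt_eqF// mulr_gt0.
- exact: dpsi.
- by rewrite /h /=; field; rewrite !gt_eqF.
Qed.

Lemma moment1_derive (x : R) : x <= 1 -> is_derive x 1 W (h x * (1 - x)).
Proof.
move=> x1; have p0 := line_gt0 x1; rewrite /W; derive_tac.
- exact: dxi1.
- exact: dxi.
- exact: p0.
- exact: dpsi.
- by rewrite gt_eqF.
- exact: dpsi.
- by move: p0; rewrite /h /psi /= => p0; field; rewrite !gt_eqF.
Qed.

(** If the residual [h] has pattern +,- with sign change at [c] and zero integral,
then int h (1 - x) = int h (c - x), whose integrand is nonnegative; it is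
positive as soon as [h] is positive somewhere away from [c]. *)
Lemma moment1_increase u c : 0 <= u < 1 -> V 1 = V u -> u <= c <= 1 ->
  (forall x, u <= x < c -> 0 <= P x) -> (forall x, c < x <= 1 -> P x <= 0) ->
  W u <= W 1 /\ ((exists x, [/\ u < x < 1, x != c & 0 < P x]) -> W u < W 1).
Proof.
move=> /andP[u0 u1] VE /andP[uc c1] n1 n2.
(* [G] is a primitive of [h (c - x)]. *)
pose G x := W x - (1 - c) * V x.
have dG (x : R) : u <= x <= 1 -> is_derive x 1 G (h x * (c - x)).
  move=> /andP[_ x1]; rewrite /G; derive_tac.
  - exact: moment1_derive.
  - exact: moment0_derive.
  - by rewrite /=; ring.
have G0 x : u < x < 1 -> 0 <= h x * (c - x).
  move=> /andP[ux x1]; rewrite residualE ?(ltW x1)//.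
  rewrite mulrAC divr_ge0 ?sqr_ge0//.
  have [xc|cx|->] := ltgtP x c; last by rewrite subrr mulr0.
    by rewrite mulr_ge0 ?n1 ?(ltW ux)// subr_ge0 ltW.
  by rewrite mulr_le0 ?n2 ?cx ?(ltW x1)// subr_le0 ltW.
have incG := derive_ge0_nondecreasing dG G0.
have GE : W 1 - W u = G 1 - G u by rewrite /G VE; ring.
split; first by rewrite -subr_ge0 GE subr_ge0 incG// ltW.
move=> [x [/andP[ux x1] xc Px]].
rewrite lt_neqAle -subr_ge0 GE subr_ge0 incG ?(ltW u1)// andbT.
apply/negP => /eqP WE.
have Gc y : u <= y <= 1 -> G y = G u.
  move=> /andP[uy y1]; apply/eqP; rewrite eq_le.
  apply/andP; split; last exact: incG.
  apply: le_trans (incG y 1 uy y1 (lexx 1)) _.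
  by rewrite -subr_le0 -GE WE subrr.
(* Equality would make [G] constant on [u, 1], although [G' x != 0]. *)
have : is_derive x 1 G 0.
  apply: (@near_eq_is_derive _ _ _ (cst (G u))) => //.
  near=> y; rewrite /cst; apply/esym/Gc; apply/andP; split; apply: ltW.
    by near: y; exact: lt_nbhsr.
  by near: y; exact: lt_nbhsl.
have xu1 : u <= x <= 1 by rewrite !ltW.
have [_ E1] := dG x xu1; move=> [_]; rewrite E1 => /eqP.
rewrite residualE ?(ltW x1)// !mulf_eq0 invr_eq0 (gt_eqF Px)/= expf_eq0/=.
by rewrite (gt_eqF (line_gt0 (ltW x1)))/= subr_eq0 eq_sym (negbTE xc).
Unshelve. all: by end_near. Qed.

Lemma residual_integrals u : 0 <= u < 1 -> V 1 = V u -> W 1 = W u ->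
  (\int[lebesgue_measure]_(x in `[u, 1%R[) (h x)%:E = 0)%E /\
  (\int[lebesgue_measure]_(x in `[u, 1%R[) (h x * (1 - x))%:E = 0)%E.
Proof.
move=> /andP[u0 u1] VE WE.
have dV (x : R) : u <= x <= 1 -> is_derive x 1 V (h x).
  by move=> /andP[_]; exact: moment0_derive.
have dW (x : R) : u <= x <= 1 -> is_derive x 1 W (h x * (1 - x)).
  by move=> /andP[_]; exact: moment1_derive.
have df (x : R) : is_derive x 1 f (b * (k.+1%:R * x ^+ k)).
  by rewrite /f; derive_tac; rewrite /=; ring.
have dh (x : R) : u <= x <= 1 ->
    is_derive x 1 h (b * (k.+1%:R * x ^+ k) - 2 * m / psi x ^+ 3).
  move=> /andP[_ /line_gt0 p0]; rewrite /h; derive_tac.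
  - exact: df.
  - by rewrite expf_eq0 gt_eqF.
  - exact: dpsi.
  - by rewrite /=; congr (_ - _); field; rewrite gt_eqF.
have ch := is_derive_within_continuous dh.
have chx : {within `[u, 1], continuous (fun x => h x * (1 - x))}.
  pose h' x := b * (k.+1%:R * x ^+ k) - 2 * m / psi x ^+ 3.
  apply: (@is_derive_within_continuous _ _ (fun x => h' x * (1 - x) - h x)).
  move=> x xu.
  derive_tac; first exact: dh.
  by rewrite /= /h'; ring.
have mI (g : R -> R) : {within `[u, 1], continuous g} ->
    measurable_fun (`[u, 1[%classic : set R) g.
  move=> cg; apply: measurable_funS (subspace_continuous_measurable_fun _ cg).
  - exact: measurable_itv.
  - by apply: subset_itvl; rewrite bnd_simp.
  - exact: measurable_itv.
split.
  rewrite integral_itv_bndo_bndc; last by apply/measurable_EFinP; exact: mI.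
  by rewrite (integral_derive dV u1 ch) VE subrr.
rewrite integral_itv_bndo_bndc; last by apply/measurable_EFinP; exact: mI.
by rewrite (integral_derive dW u1 chx) WE subrr.
Qed.
End Line.

(** * The equation defining z *)

Section EntropyRatio.
Context {R : realType}.
Implicit Types (z T : R).

Definition log_ratio z := (1 + z) / z ^+ 2 * ln (1 + z) - z^-1.

(** Equivalent to [ln (1 + x) >= 2 x / (2 + x)]. It shows that [log_ratio] comes
close to 1/2, hence above any [T^-1] with [T > 2], near 0. *)
Lemma log_ratio_ge z : 0 < z -> (2 + z)^-1 <= log_ratio z.
Proof.
move=> z0.
pose G x := ln (1 + x) - 2 * x / (2 + x) : R.
have dG (x : R) : 0 <= x <= z -> is_derive x 1 G (x ^+ 2 / ((1 + x) * (2 + x) ^+ 2)).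
  move=> /andP[x0 _].
  have x1 : 0 < 1 + x by lra.
  have x2 : 2 + x != 0 by rewrite gt_eqF//; lra.
  rewrite /G; derive_tac => //.
  by rewrite /=; field; rewrite x2 gt_eqF.
have G0 : 0 <= G z.
  have -> : 0 = G 0 by rewrite /G addr0 ln1 mulr0 mul0r subrr.
  apply: (derive_ge0_nondecreasing dG) => //; last exact: ltW.
  move=> x /andP[x0 _]; rewrite divr_ge0 ?sqr_ge0// mulr_ge0 ?sqr_ge0//; lra.
have -> : log_ratio z = (2 + z)^-1 + (1 + z) / z ^+ 2 * G z.
  by rewrite /log_ratio /G; field; rewrite !gt_eqF//; lra.
rewrite lerDl mulr_ge0// divr_ge0 ?sqr_ge0//; lra.
Qed.

(** With [1 + z = y^2] and [y = 2 T], the bound [ln y <= y - 1] gives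
[log_ratio z <= (2 y + 1) / (y + 1)^2 <= 2 / y]. *)
Lemma log_ratio_le T : 1 <= T -> log_ratio ((2 * T) ^+ 2 - 1) <= T^-1.
Proof.
move=> T1; set y := 2 * T; have y2 : 2 <= y by rewrite /y; lra.
have lny : ln y <= y - 1.
  have {1}-> : y = 1 + (y - 1) by ring.
  by apply: le_ln1Dx; lra.
have E : log_ratio (y ^+ 2 - 1) = (2 * y + 1) / (y + 1) ^+ 2 -
    2 * y ^+ 2 / (y ^+ 2 - 1) ^+ 2 * (y - 1 - ln y).
  rewrite /log_ratio [1 + _]addrC subrK lnXn; last lra.
  rewrite -[ln y *+ 2]mulr_natl; field.
  by apply/andP; split; rewrite gt_eqF//; nra.
rewrite E; apply: (@le_trans _ _ ((2 * y + 1) / (y + 1) ^+ 2)).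
  rewrite gerBl mulr_ge0 ?subr_ge0// divr_ge0 ?sqr_ge0// mulr_ge0 ?sqr_ge0//; lra.
have -> : T^-1 = 2 / y by rewrite /y; field; rewrite gt_eqF//; lra.
rewrite ler_pdivrMr ?exprn_gt0//; last lra.
rewrite mulrAC ler_pdivlMr; last lra.
by nra.
Qed.

(** The extra bound [z <= Z] is what turns an upper estimate of [log_ratio] at a
point into an upper estimate of the solution. *)
Lemma log_ratio_root T Z : 2 < T -> 0 < Z -> log_ratio Z <= T^-1 ->
  exists z, [/\ 0 < z, z <= Z & log_ratio z = T^-1].
Proof.
(* Below [T - 2] the bound [(2 + z)^-1] exceeds [T^-1]. *)
move=> T2 Z0 HZ; pose e := Num.min (T - 2) Z.
have e0 : 0 < e by rewrite lt_min Z0 subr_gt0 T2.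
have eZ : e <= Z by rewrite ge_min lexx orbT.
have eT : e <= T - 2 by rewrite ge_min lexx.
have He : T^-1 <= log_ratio e.
  by apply: le_trans (log_ratio_ge e0); rewrite lef_pV2 ?posrE; lra.
have dG (x : R) : e <= x <= Z -> exists d, is_derive x 1 (fun z => log_ratio z - T^-1) d.
  move=> /andP[ex _]; have x0 : 0 < x by lra.
  eexists; rewrite /log_ratio; derive_rules.
  - by rewrite expf_eq0 gt_eqF.
  - by lra.
  - by apply: (is_derive_invf _ (is_derive_idf x)); rewrite gt_eqF.
have [|//||z /andP[ez zZ] /eqP] := @continuous_zero _ (fun z => log_ratio z - T^-1) e Z.
- apply: continuous_in_subspaceT => x /set_mem; rewrite /= in_itv/= => /dG[d [dx _]].
  exact/differentiable_continuous/derivable1_diffP.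
- by rewrite mulr_ge0_le0 ?subr_ge0 ?subr_le0.
- rewrite subr_eq0 => /eqP zE; exists z; split => //; lra.
Qed.
End EntropyRatio.

(** * Solving for the affine part *)

Section MixtureCertificates.
Context {R : realType}.
Variables (k : nat) (l : R).
Hypotheses (l0 : 0 <= l) (l1 : l < 1).
Let k0 : 0 <= k%:R :> R. Proof. exact: ler0n. Qed.

Definition hess_a : R := 2 * l.

Definition hess_b : R := (k%:R + 3) * (k%:R + 2) * (1 - l).

Definition mix_slope (x : R) : R := 2 * l * x + (k%:R + 3) * (1 - l) * x ^+ k.+2.
Local Notation xi := (mixture k.+3 l).
Local Notation a := hess_a.
Local Notation b := hess_b.
Local Notation f := (hess k a b).
Local Notation T := (mix_slope 1).

Lemma mixture_derive (x : R) : is_derive x 1 xi (mix_slope x).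
Proof. by rewrite /mixture; derive_tac; rewrite /mix_slope /=; ring. Qed.

Lemma mix_slope_derive (x : R) : is_derive x 1 mix_slope (f x).
Proof. by rewrite /mix_slope; derive_tac; rewrite /hess /hess_a /hess_b /=; ring. Qed.

Lemma hess_b_gt0 : 0 < b. Proof. by rewrite !mulr_gt0 ?subr_gt0//; lra. Qed.

Let TE : T = 2 * l + (k%:R + 3) * (1 - l).
Proof. by rewrite /mix_slope expr1n !mulr1. Qed.

Let T2 : 2 < T.
Proof.
have : 0 < (k%:R + 1) * (1 - l) by rewrite mulr_gt0 ?subr_gt0//; lra.
by rewrite TE; lra.
Qed.

Let T_gt0 : 0 < T. Proof. exact: lt_trans T2. Qed.

Local Notation V D m := (moment0 D m mix_slope).
Local Notation W D m := (moment1 D m xi mix_slope).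

(** The condition on [D] is what the vanishing of the first integral amounts to
when [m = z D]; the second integral then equals [1 - xi'(1) log_ratio z], hence
the equation that defines z. *)
Lemma linear_moments (z D : R) : 0 < z -> 0 < D -> D ^+ 2 * (T * (1 + z)) = 1 ->
  V D (z * D) 1 = V D (z * D) 0 /\
  W D (z * D) 1 - W D (z * D) 0 = 1 - T * log_ratio z.
Proof.
move=> z0 D0 DE.
have T0 := T_gt0.
have mix_slope0 : mix_slope 0 = 0 by rewrite /mix_slope exprS !mulr0 mul0r mulr0 addr0.
have zn : z != 0 by rewrite gt_eqF. have Dn : D != 0 by rewrite gt_eqF.
have z1n : 1 + z != 0 by rewrite gt_eqF//; lra.
have Tn : T != 0 by rewrite gt_eqF.
have TD : T = (D ^+ 2 * (1 + z))^-1.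
  apply: (mulfI (_ : D ^+ 2 * (1 + z) != 0)); first by rewrite mulf_neq0 ?expf_neq0.
  by rewrite mulfV ?mulf_neq0 ?expf_neq0// -[RHS]DE; ring.
split.
  rewrite /moment0 /line mix_slope0 !subr0 subrr mulr0 addr0 mulr1.
  rewrite TD; field.
  by rewrite zn Dn z1n (_ : D + z * D = D * (1 + z)) ?mulf_neq0//; ring.
have xi1 : xi 1 = 1 by rewrite /mixture !expr1n; ring.
have xi0 : xi 0 = 0 by rewrite /mixture !exprS !mul0r !mulr0 addr0.
rewrite /moment1 /line mix_slope0 xi1 xi0 !subr0 subrr mulr0 addr0 mul0r mulr0 mulr1 !add0r.
have -> : D + z * D = D * (1 + z) by ring.
rewrite lnM ?posrE//; last lra.
rewrite {1}TD /log_ratio; field.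
by rewrite zn Dn z1n.
Qed.

Lemma linear_certificate (z : R) : 0 < z -> log_ratio z = T^-1 ->
  2 * l * z <= (k%:R + 3) * (1 - l) ->
  exists D m, [/\ 0 < D, 0 < m, V D m 1 = V D m 0, W D m 1 = W D m 0 &
    gap k a b D m 0 <= 0].
Proof.
move=> z0 zT zle.
have T0 := T_gt0.
have Tz0 : 0 < T * (1 + z) by rewrite mulr_gt0//; lra.
(* With this value [gap] at 0 is [a (D + m)^2 - 1 = a (1 + z) / xi'(1) - 1]. *)
pose D := Num.sqrt (T * (1 + z))^-1.
have D0 : 0 < D by rewrite sqrtr_gt0 invr_gt0.
have DE : D ^+ 2 * (T * (1 + z)) = 1.
  by rewrite sqr_sqrtr ?invr_ge0 ?ltW// mulVf// gt_eqF.
have [VE WE] := linear_moments z0 D0 DE.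
exists D, (z * D); split => //; first by rewrite mulr_gt0.
  apply/eqP; rewrite -subr_eq0 WE zT mulfV ?subrr// gt_eqF//.
rewrite /gap /hess /line exprS !mul0r mulr0 addr0 subr0 mulr1.
have -> : (D + z * D) ^+ 2 = D ^+ 2 * (1 + z) * (1 + z) by ring.
rewrite subr_le0 -(ler_pM2r T0) mul1r.
have -> : hess_a * (D ^+ 2 * (1 + z) * (1 + z)) * T =
  hess_a * (1 + z) * (D ^+ 2 * (T * (1 + z))) by ring.
by rewrite DE mulr1 /hess_a TE; lra.
Qed.

Lemma log_ratio_solution : exists2 z, 0 < z & log_ratio z = T^-1.
Proof.
have [||z [z0 _ zE]] := @log_ratio_root R T ((2 * T) ^+ 2 - 1) T2.
- by have := T2; rewrite subr_gt0; nra.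
- by apply: log_ratio_le; have := T2; lra.
by exists z.
Qed.

Lemma zetaP : 0 < zeta k.+3 l /\ log_ratio (zeta k.+3 l) = T^-1.
Proof.
rewrite /zeta lt_eqF//.
have dE : derive1 xi 1 = T.
  by rewrite derive1E; have [_ ->] := mixture_derive 1.
set Z := [set z | _].
have [z z0 zE] := log_ratio_solution.
have : Z (xget 0 Z).
  by apply: (@xgetPex _ 0 Z); exists z; split => //; rewrite dE -zE.
by move=> [z0' zE']; split => //; rewrite /log_ratio -zE' dE.
Qed.

Hypothesis lpos : 0 < l.
Let a0 : 0 < a. Proof. by rewrite /hess_a mulr_gt0. Qed.

Let sf u := Num.sqrt (f u).

(** The value at 1 of the affine function that equals [f u ^ (-1/2)] at [u] and
makes the residual integrate to 0 over [u, 1]. *)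
Definition tangent_D u := (1 - u) * Num.sqrt (f u) / (T - mix_slope u).

Definition tangent_m u := ((Num.sqrt (f u))^-1 - tangent_D u) / (1 - u).

(** The integral of the residual times [1 - x] over [u, 1] for that affine
function ([tangent_moment1]). *)
Definition tangent_excess u := xi 1 - xi u - (1 - u) * mix_slope u +
  (ln (tangent_D u) + ln (Num.sqrt (f u)) + 1 - tangent_D u * Num.sqrt (f u))
  / tangent_m u ^+ 2.
Local Notation tD := tangent_D.
Local Notation tm := tangent_m.
Let f_gt0 u : 0 <= u -> 0 < f u.
Proof. by move=> u0; rewrite ltr_pwDl// mulr_ge0 ?exprn_ge0// ltW// hess_b_gt0. Qed.

Let sf_gt0 u : 0 <= u -> 0 < sf u.
Proof. by move=> u0; rewrite sqrtr_gt0 f_gt0. Qed.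

Let sfE u : 0 <= u -> sf u ^+ 2 = f u.
Proof. by move=> u0; rewrite sqr_sqrtr// ltW// f_gt0. Qed.

(** [xi'] is strictly convex, so it lies above its tangent at [u]. *)
Lemma mix_slope_strictly_convex u : 0 <= u < 1 -> (1 - u) * f u < T - mix_slope u.
Proof.
move=> /andP[u0 u1].
pose G x := mix_slope x - x * f u.
have dG (x : R) : u <= x <= 1 -> is_derive x 1 G (f x - f u).
  move=> _; rewrite /G; derive_tac; first exact: mix_slope_derive.
  by rewrite /=; ring.
have : G u < G 1.
  apply: (derive_gt0_increasing dG) => // x /andP[ux _].
  rewrite subr_gt0 /hess ltrD2l ltr_pM2l ?hess_b_gt0// ltrXn2r ?nnegrE//.
by rewrite /G => h; rewrite -subr_gt0; move: h; rewrite -subr_gt0; congr (0 < _); ring.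
Qed.

Lemma tangent_den u : 0 <= u < 1 -> 0 < T - mix_slope u.
Proof.
move=> u01; have /andP[u0 u1] := u01.
apply: lt_trans (mix_slope_strictly_convex u01).
by rewrite mulr_gt0 ?subr_gt0 ?f_gt0.
Qed.

Lemma tangent_D_gt0 u : 0 <= u < 1 -> 0 < tD u.
Proof.
move=> u01; have /andP[u0 u1] := u01.
by rewrite divr_gt0 ?tangent_den ?mulr_gt0 ?subr_gt0 ?sf_gt0.
Qed.

Lemma tangent_m_gt0 u : 0 <= u < 1 -> 0 < tm u.
Proof.
move=> u01; have /andP[u0 u1] := u01.
rewrite divr_gt0 ?subr_gt0//.
have s0 := sf_gt0 u0; have t0 := tangent_den u01.
rewrite -/(sf u) -[(sf u)^-1]mul1r /tangent_D ltr_pdivrMr// mulrAC.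
rewrite ltr_pdivlMr// mul1r -mulrA -expr2 sfE//.
exact: mix_slope_strictly_convex.
Qed.

Lemma tangent_line u : 0 <= u < 1 -> line (tD u) (tm u) u = (sf u)^-1.
Proof.
move=> /andP[u0 u1]; rewrite /line /tangent_m divfK; last by rewrite gt_eqF// subr_gt0.
by rewrite addrC subrK.
Qed.

Lemma tangent_gap u : 0 <= u < 1 -> gap k a b (tD u) (tm u) u = 0.
Proof.
move=> u01; have /andP[u0 u1] := u01.
by rewrite /gap tangent_line// exprVn sfE// mulfV ?subrr// gt_eqF// f_gt0.
Qed.

Lemma tangent_moment0 u : 0 <= u < 1 -> V (tD u) (tm u) 1 = V (tD u) (tm u) u.
Proof.
move=> u01; have /andP[u0 u1] := u01.
have s0 := sf_gt0 u0; have t0 := tangent_den u01.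
have m0 := tangent_m_gt0 u01; have d0 := tangent_D_gt0 u01.
rewrite /moment0 tangent_line// [line _ _ 1]/line subrr mulr0 addr0.
have mE : tm u * (1 - u) * sf u = 1 - tD u * sf u.
  rewrite /tangent_m divfK; last by rewrite gt_eqF// subr_gt0.
  by rewrite mulrBl mulVf ?gt_eqF.
have TE' : T - mix_slope u = (1 - u) * sf u / tD u.
  by rewrite /tangent_D /sf; field; rewrite !gt_eqF// subr_gt0.
have -> : (tm u * tD u)^-1 = (tm u * (sf u)^-1)^-1 + (1 - tD u * sf u) / (tm u * tD u).
  by field; rewrite !gt_eqF.
rewrite -mE; have -> : tm u * (1 - u) * sf u / (tm u * tD u) = T - mix_slope u.
  by rewrite TE'; field; rewrite !gt_eqF.
by ring.
Qed.

Lemma tangent_moment1 u : 0 <= u < 1 ->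
  W (tD u) (tm u) 1 - W (tD u) (tm u) u = tangent_excess u.
Proof.
move=> u01; have /andP[u0 u1] := u01.
have s0 := sf_gt0 u0.
have m0 := tangent_m_gt0 u01; have d0 := tangent_D_gt0 u01.
rewrite /moment1 tangent_line// [line _ _ 1]/line subrr mulr0 addr0.
rewrite lnV ?posrE// invrK /tangent_excess -/(sf u).
by field; rewrite !gt_eqF.
Qed.

Lemma tangent_excess_continuous (v : R) : v < 1 ->
  {within `[0, v], continuous tangent_excess}.
Proof.
move=> v1; apply: continuous_in_subspaceT => u /set_mem; rewrite /= in_itv/=.
move=> /andP[u0 uv]; have u01 : 0 <= u < 1 by rewrite u0 (le_lt_trans uv).
have [d [dF _]] : exists d, is_derive u 1 tangent_excess d.
  have df (x : R) : is_derive x 1 f (b * (k.+1%:R * x ^+ k)).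
    by rewrite /hess; derive_tac; rewrite /=; ring.
  have u1n : 1 - u != 0 by have /andP[_ ?] := u01; rewrite gt_eqF// subr_gt0.
  have tn : T - mix_slope u != 0 by rewrite gt_eqF// tangent_den.
  have sn : Num.sqrt (f u) != 0 by rewrite gt_eqF// sf_gt0.
  have mn : tm u ^+ 2 != 0 by rewrite expf_eq0/= gt_eqF// tangent_m_gt0.
  have [dD dDE] : exists d, is_derive u 1 tD d.
    eexists; rewrite /tangent_D; derive_rules;
    by [exact: f_gt0|exact: df|exact: tn|exact: mix_slope_derive].
  have [dm dmE] : exists d, is_derive u 1 tm d.
    eexists; rewrite /tangent_m; derive_rules;
    by [exact: f_gt0|exact: df|exact: sn|exact: dDE|exact: u1n].
  eexists; rewrite /tangent_excess; derive_rules;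
  by [exact: mixture_derive|exact: mix_slope_derive|exact: tangent_D_gt0|exact: dDE|
      exact: sf_gt0|exact: f_gt0|exact: df|exact: mn|exact: dmE].
exact/differentiable_continuous/derivable1_diffP.
Qed.

Let z0 := (k%:R + 3) * (1 - l) / (2 * l).

(** At [u = 0] the affine function is the one of [linear_moments] for the value
[z0] of z at which [2 lambda z = s (1 - lambda)], so the sign of the excess
tells whether [log_ratio z0] is below or above [1 / xi'(1)]. *)
Lemma tangent_excess0 : tangent_excess 0 = 1 - T * log_ratio z0.
Proof.
have s0 : 0 < sf 0 by exact: sf_gt0.
have sE : sf 0 ^+ 2 = 2 * l by rewrite sfE// /hess exprS mul0r mulr0 addr0.
have l2 : 2 * l != 0 by rewrite mulf_neq0// gt_eqF.
have z00 : 0 < z0.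
  by rewrite /z0 divr_gt0 ?mulr_gt0 ?subr_gt0//; have := k0; lra.
have Tz : T = 2 * l * (1 + z0).
  by rewrite TE /z0; field; move: l2; rewrite mulf_eq0 negb_or => /andP[].
have u01 : 0 <= (0 : R) < 1 by rewrite lexx ltr01.
have mix_slope0 : mix_slope 0 = 0 by rewrite /mix_slope exprS !mulr0 mul0r mulr0 addr0.
have z1 : 1 + z0 != 0 by rewrite gt_eqF//; lra.
have DE : tD 0 = (sf 0 * (1 + z0))^-1.
  rewrite /tangent_D mix_slope0 !subr0 mul1r -/(sf 0) Tz -sE.
  by field; rewrite z1 gt_eqF.
have mE : tm 0 = z0 * tD 0.
  rewrite /tangent_m -/(sf 0) subr0 divr1 DE.
  by field; rewrite z1 gt_eqF.
have D2 : tD 0 ^+ 2 * (T * (1 + z0)) = 1.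
  by rewrite DE Tz -sE; field; rewrite z1 gt_eqF.
have [_ <-] := linear_moments z00 (tangent_D_gt0 u01) D2.
by rewrite -mE tangent_moment1.
Qed.

Hypothesis convex_at1 : 2 * k%:R * a < b * (k%:R + 3).

(** [v] is the inflexion point of [f^(-1/2)], which is concave before it; [c] is
the power of [v] that occurs in [f]. *)
Let c := 2 * k%:R * a / (b * (k%:R + 3)).
Let v := c `^ (k.+1%:R^-1).

Let bk3 : 0 < b * (k%:R + 3).
Proof. by rewrite mulr_gt0 ?hess_b_gt0//; have := k0; lra. Qed.

Let c0 : 0 <= c.
Proof. by rewrite divr_ge0 ?(ltW bk3)// !mulr_ge0// ltW. Qed.

Let vE : v ^+ k.+1 = c.
Proof.
by rewrite -powR_mulrn ?powR_ge0// -powRrM mulVf ?powRr1//.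
Qed.

Let v0 : 0 <= v. Proof. exact: powR_ge0. Qed.

Let v1 : v < 1.
Proof.
rewrite ltNge; apply/negP => v1.
have : 1 <= c by rewrite -vE exprn_ege1.
by rewrite leNgt ltr_pdivrMr// mul1r convex_at1.
Qed.

Let v01 : 0 <= v < 1. Proof. by rewrite v0 v1. Qed.

(** At the inflexion point, [gap_slope] is positive exactly when the peak is
still ahead: in either case [gap], if it
vanishes there, has pattern +,- from this point on. *)
Lemma inflexion_slope (D m : R) : 0 < D -> 0 < m ->
  v * gap_slope k a b D m v =
  2 * a * (k%:R + 1) * m * (peak k D m - v).
Proof.
move=> D0 m0; have k3 : k%:R + 3 != 0 :> R by rewrite gt_eqF//; have := k0; lra.
have b0 : b != 0 by rewrite gt_eqF// hess_b_gt0.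
have -> : v * gap_slope k a b D m v = b * v ^+ k.+1 * (k%:R + 1) * line D m v -
    2 * m * v * (a + b * v ^+ k.+1).
  by rewrite /gap_slope /hess exprS; ring.
have -> : b * v ^+ k.+1 = 2 * k%:R * a / (k%:R + 3).
  by rewrite vE /c; field; rewrite k3 b0.
by rewrite /peak /line; field; rewrite k3 gt_eqF.
Qed.

(** From the inflexion point on, [gap] has pattern +,-, so the comparison of
moments applies. *)
Lemma tangent_excess_inflexion : 0 <= tangent_excess v.
Proof.
have D0 := tangent_D_gt0 v01; have m0 := tangent_m_gt0 v01.
have v01' : 0 <= v <= 1 by rewrite v0 ltW.
have alt : peak k (tD v) (tm v) <= v \/ 0 < gap_slope k a b (tD v) (tm v) v.
  have [|pv] := leP (peak k (tD v) (tm v)) v; first by left.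
  right; have vpos : 0 < v.
    rewrite lt_neqAle v0 andbT eq_sym; apply/eqP => vz.
    have : k%:R = 0 :> R.
      have := vE; rewrite vz exprS mul0r => /esym /eqP.
      rewrite mulf_eq0 invr_eq0 (gt_eqF bk3) orbF -mulrA mulrCA mulf_eq0 mulf_eq0.
      by rewrite (gt_eqF a0) (pnatr_eq0 _ 2)/= orbF => /eqP.
    by move=> kz; move: pv; rewrite /peak kz !mul0r vz ltxx.
  rewrite -(pmulr_rgt0 _ vpos) inflexion_slope// mulr_gt0 ?subr_gt0//.
  have k1 : 0 < k%:R + 1 :> R by have := k0; lra.
  by rewrite mulr_gt0// mulr_gt0// mulr_gt0.
have [e [e01 e1 e2]] := gap_signs_tangent hess_b_gt0 D0 m0 v01' (tangent_gap v01) alt.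
have [le _] := moment1_increase D0 m0 mixture_derive mix_slope_derive v01
  (tangent_moment0 v01) e01 e1 e2.
by rewrite -tangent_moment1// subr_ge0.
Qed.

(** If [gap] increased at [u], its pattern on [u, 1] would be +,- and the excess
would be positive. *)
Lemma tangent_slope_le0 (u : R) : 0 <= u < 1 -> tangent_excess u = 0 ->
  gap_slope k a b (tD u) (tm u) u <= 0.
Proof.
move=> u01 Fu; rewrite leNgt; apply/negP => ru.
have u01' : 0 <= u <= 1 by have /andP[-> /ltW] := u01.
have D0 := tangent_D_gt0 u01; have m0 := tangent_m_gt0 u01.
have [e [e01 e1 e2]] := gap_signs_tangent hess_b_gt0 D0 m0 u01' (tangent_gap u01)
  (or_intror ru).
have [_] := moment1_increase D0 m0 mixture_derive mix_slope_derive u01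
  (tangent_moment0 u01) e01 e1 e2.
move=> /(_ (gap_gt0_right D0 m0 e u01 (tangent_gap u01) ru)).
by rewrite -subr_gt0 tangent_moment1// Fu ltxx.
Qed.

(** If the excess is positive at 0, then [log_ratio z0 <= 1 / xi'(1)], so the
solution z lies below [z0]. Otherwise the excess changes sign between 0 and the
inflexion point; a zero at 0 itself is again the case [z = z0]. *)
Lemma tangent_dichotomy :
  (exists z, [/\ 0 < z, log_ratio z = T^-1 & 2 * l * z <= (k%:R + 3) * (1 - l)])
  \/ (exists u, [/\ 0 < u < 1, tangent_excess u = 0 &
        b * (k%:R + 3) * u ^+ k.+1 <= 2 * k%:R * a]).
Proof.
have l2 : 0 < 2 * l by rewrite mulr_gt0.
have z00 : 0 < z0.
  by rewrite /z0 divr_gt0 ?mulr_gt0 ?subr_gt0//; have := k0; lra.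
have z0E : 2 * l * z0 = (k%:R + 3) * (1 - l).
  by rewrite /z0 mulrC divfK// gt_eqF.
have F0 := tangent_excess0; have T0 := T_gt0.
have [F0le|F0gt] := leP (tangent_excess 0) 0; last first.
  left; have Hz0 : log_ratio z0 <= T^-1.
    by rewrite -[T^-1]mul1r ler_pdivlMr// mulrC ltW// -subr_gt0 -F0.
  have [z [zpos zz0 zE]] := log_ratio_root T2 z00 Hz0.
  by exists z; split => //; rewrite -z0E ler_pM2l.
have Fv := tangent_excess_inflexion.
have [|u /andP[u0 uv] Fu] := continuous_zero (tangent_excess_continuous v1) v0.
  by rewrite mulr_le0_ge0.
have [uz|upos] := eqVneq u 0.
  left; exists z0; split => //; last by rewrite z0E.
  move: F0; rewrite -uz Fu => /esym/eqP; rewrite subr_eq0 => /eqP E.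
  by apply: (mulfI (lt0r_neq0 T0)); rewrite mulfV ?gt_eqF.
right; exists u; split => //.
  by rewrite lt_neqAle eq_sym upos u0 (le_lt_trans uv v1).
rewrite mulrC -ler_pdivlMr// -/c -vE lerXn2r// ?nnegrE//.
Qed.
End MixtureCertificates.

(** * The certificate for the mixture *)

Section MixtureCriterion.
Context {R : realType}.
Variables (k : nat) (l : R).
Hypotheses (l0 : 0 <= l) (l1 : l <= 1).
Local Notation xi := (mixture k.+3 l).
Local Notation a := (hess_a l).
Local Notation b := (hess_b k l).
Local Notation f := (hess k a b).
Local Notation mu := (@lebesgue_measure R).

Let b0 : 0 <= b.
Proof.
have k0 : 0 <= k%:R :> R by exact: ler0n.
by rewrite /hess_b !mulr_ge0 ?subr_ge0//; lra.
Qed.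

Let a0 : 0 <= a. Proof. by rewrite /hess_a mulr_ge0. Qed.

Let derive1_xi : derive1 xi = mix_slope k l.
Proof.
apply/funext => x; rewrite derive1E.
by have [_ ->] := mixture_derive k l x.
Qed.

Let cf : continuous f.
Proof.
have df (x : R) : is_derive x 1 f (b * (k.+1%:R * x ^+ k)).
  by rewrite /hess; derive_tac; rewrite /=; ring.
by move=> x; apply/differentiable_continuous/derivable1_diffP; have [] := df x.
Qed.

Let cmix_slope : continuous (mix_slope k l).
Proof.
move=> x; apply/differentiable_continuous/derivable1_diffP.
by have [] := mix_slope_derive k l x.
Qed.

Lemma mixture_parisi (gamma psi : R -> R) (D m u p q : R) :
  admissible_density gamma -> 0 < D ->
  (forall x, 0 <= x < 1 ->
    (\int[mu]_(t in `]x, 1%R[) (gamma t)%:E = (psi x - D)%:E)%E) ->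
  0 <= u -> u <= p -> p <= q -> q <= 1 ->
  (forall x, u <= x < 1 -> psi x = line D m x) ->
  (forall x, 0 <= x < u -> f x - psi x ^- 2 = 0) ->
  (forall x, u <= x < p -> residual k a b D m x <= 0) ->
  (forall x, p < x < q -> 0 <= residual k a b D m x) ->
  (forall x, q < x < 1 -> residual k a b D m x <= 0) ->
  (\int[mu]_(x in `[u, 1%R[) (residual k a b D m x)%:E = 0)%E ->
  (\int[mu]_(x in `[u, 1%R[) (residual k a b D m x * (1 - x))%:E = 0)%E ->
  exists2 nu : borel_measure R,
    is_parisi_measure xi nu & has_form nu gamma D.
Proof.
move=> adm D0 igamma u0 up pq q1 lin h0 h1 h2 h3 ih0 ih1.
have m01 : measurable (`[0, 1[%classic : set R) by exact: measurable_itv.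
have g0 (x : R) : `[0, 1[%classic x -> 0 <= gamma x.
  by case: adm => g0 _ _; exact: g0.
have [nu nuE] := density_atom_measure 1 m01 (admissible_measurable adm) g0 (ltW D0).
have form : has_form nu gamma D by split.
have psiE (x : R) : 0 <= x < 1 -> nu `]x, 1]%classic = (psi x)%:E.
  move=> x01; have /andP[x0 x1] := x01.
  by rewrite (form_itv1 form)// igamma// -EFinD subrK.
have nuoo : (nu setT < +oo)%E.
  rewrite nuE; last exact: measurableT.
  rewrite setTI diracE mem_set// mule1 lte_add_pinfty ?ltry//.
  rewrite -integral_itv_obnd_cbnd.
    by rewrite igamma ?lexx ?ltr01// ltry.
  apply/measurable_EFinP; apply: measurable_funS (admissible_measurable adm) => //.
  by apply: subset_itvr; rewrite bnd_simp.
have [phi prof] := form_profile form nuoo.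
have phiE (x : R) : 0 <= x < 1 -> phi x = psi x.
  move=> x01; have [nuphi _ _ _] := prof.
  by have := nuphi x x01; rewrite psiE// => -[].
have philin (x : R) : u <= x < 1 -> phi x = line D m x.
  move=> ux; rewrite phiE ?lin//; have /andP[ux' ->] := ux.
  by rewrite (le_trans u0).
have resE (x : R) : u <= x < 1 -> f x - phi x ^- 2 = residual k a b D m x.
  by move=> ux; rewrite philin.
exists nu => //.
apply: (@parisi_criterion R xi f (a + b) _ _ _ _ _ _ nu gamma phi D m u p q) => //.
- by apply: measurable_funTS; exact: continuous_measurable_fun.
- by move=> x /andP[x0 _]; rewrite /hess addr_ge0// mulr_ge0// exprn_ge0.
- move=> x /andP[x0 x1]; rewrite /hess lerD2l -[leRHS]mulr1 ler_wpM2l//.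
  exact: exprn_ile1.
- move=> y /andP[y0 y1]; rewrite derive1_xi.
  have mix_slope0 : mix_slope k l 0 = 0 by rewrite /mix_slope exprS !mulr0 mul0r mulr0 addr0.
  move: y0; rewrite le_eqVlt => /predU1P[<-|y0].
    by rewrite set_itv_ge ?bnd_simp// integral_set0 mix_slope0.
  rewrite integral_itv_bndo_bndc; last first.
    by apply/measurable_EFinP/measurable_funTS; exact: continuous_measurable_fun.
  have -> := @integral_derive R (mix_slope k l) f 0 y (fun x _ => mix_slope_derive k l x) y0.
    by rewrite mix_slope0 subr0.
  exact: continuous_subspaceT.
- rewrite derive1_xi; apply: measurable_funTS.
  exact: continuous_measurable_fun.
- rewrite derive1_xi /mix_slope.
  have h0' : 0 < 2^-1 :> R by rewrite invr_gt0.
  have k3 : 0 < k%:R + 3 :> R by rewrite ltr_wpDl.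
  have [lz|lpos] := eqVneq l 0.
    by rewrite lz mulr0 mul0r add0r subr0 mulr1 mulr_gt0 ?exprn_gt0.
  have lgt0 : 0 < l by rewrite lt_neqAle eq_sym lpos l0.
  rewrite ltr_pwDl ?mulr_gt0//.
  apply: mulr_ge0; last by apply: exprn_ge0; exact: ltW.
  by apply: mulr_ge0; rewrite ?subr_ge0// ltW.
- by move=> x x01; rewrite phiE ?h0//; have /andP[-> xu] := x01;
    rewrite (lt_le_trans xu)// (le_trans up)// (le_trans pq).
- by move=> x xp; rewrite resE ?h1//; have /andP[-> xp'] := xp;
    rewrite (lt_le_trans xp')// (le_trans pq).
- move=> x xpq; rewrite resE ?h2//; have /andP[px xq] := xpq.
  by rewrite (le_trans up (ltW px)) (lt_le_trans xq).
- move=> x xq; rewrite resE ?h3//; have /andP[qx ->] := xq.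
  by rewrite (le_trans up (le_trans pq (ltW qx))).
- rewrite -[RHS]ih0; apply: eq_integral => x /set_mem; rewrite /= in_itv/= => ux.
  by rewrite resE.
- rewrite -[RHS]ih1; apply: eq_integral => x /set_mem; rewrite /= in_itv/= => ux.
  by rewrite resE.
Qed.
End MixtureCriterion.

(** * Densities with a curved part and a plateau *)

Section FullDensity.
Context {R : realType}.
Variables (k : nat) (a b u : R).
Hypotheses (k_gt0 : (0 < k)%N) (a0 : 0 < a) (b0 : 0 < b) (u0 : 0 < u).
Hypothesis convex_u : b * (k%:R + 3) * u ^+ k.+1 <= 2 * k%:R * a.
Local Notation f := (hess k a b).
Local Notation S x := (Num.sqrt (f x)).
Local Notation mu := (@lebesgue_measure R).

(** The density whose profile is [f^(-1/2)]. *)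
Definition full_density (x : R) : R :=
  b * (k%:R + 1) * x ^+ k / (2 * S x ^+ 3).

(** Its derivative; [convex_u] says that it is nonnegative up to [u]. *)
Definition full_density' (x : R) : R :=
  b * (k%:R + 1) * x ^+ k.-1 * (2 * k%:R * a - b * (k%:R + 3) * x ^+ k.+1)
  / (4 * S x ^+ 5).
Local Notation kappa := full_density.
Local Notation kappa' := full_density'.
Let k0 : 0 <= k%:R :> R. Proof. exact: ler0n. Qed.

Let f_gt0 x : 0 <= x -> 0 < f x.
Proof. by move=> x0; rewrite ltr_pwDl// mulr_ge0 ?exprn_ge0// ltW. Qed.

Let S_gt0 x : 0 <= x -> 0 < S x.
Proof. by move=> x0; rewrite sqrtr_gt0 f_gt0. Qed.

Let SE x : 0 <= x -> S x ^+ 2 = f x.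
Proof. by move=> x0; rewrite sqr_sqrtr// ltW// f_gt0. Qed.

Let df (x : R) : is_derive x 1 f (b * ((k%:R + 1) * x ^+ k)).
Proof. by rewrite /hess; derive_tac; rewrite /=; ring. Qed.

Lemma inv_sqrt_derive (x : R) : 0 <= x ->
  is_derive x 1 (fun y => - (S y)^-1) (kappa x).
Proof.
move=> x0; have s0 := S_gt0 x0; derive_tac.
- by rewrite gt_eqF.
- exact: f_gt0.
- exact: df.
- by rewrite /full_density /=; field; rewrite gt_eqF.
Qed.

Lemma full_density_derive (x : R) : 0 <= x -> is_derive x 1 kappa (kappa' x).
Proof.
move=> x0; have s0 := S_gt0 x0; rewrite /full_density; derive_tac.
- by rewrite mulf_neq0 ?expf_neq0 ?gt_eqF.
- exact: f_gt0.
- exact: df.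
have xk : x ^+ k = x * x ^+ k.-1 by rewrite -exprS prednK.
have aE : a = S x ^+ 2 - b * (x * (x * x ^+ k.-1)).
  by rewrite SE// /hess exprS xk; ring.
rewrite /full_density' /= (exprS x k) xk.
move: (S x) s0 aE => s s0 ->.
by field; rewrite gt_eqF.
Qed.

Lemma full_density_ge0 x : 0 <= x -> 0 <= kappa x.
Proof.
by move=> x0; rewrite divr_ge0 ?mulr_ge0 ?exprn_ge0 ?sqrtr_ge0 ?(ltW b0).
Qed.

Lemma full_density'_gt0 x : 0 < x < u -> 0 < kappa' x.
Proof.
move=> /andP[x0 xu]; have s0 := S_gt0 (ltW x0).
have k1 : 0 < k%:R + 1 :> R by rewrite ltr_wpDl.
have k3 : 0 < k%:R + 3 :> R by rewrite ltr_wpDl.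
rewrite divr_gt0 ?mulr_gt0 ?exprn_gt0// subr_gt0.
apply: lt_le_trans convex_u; rewrite ltr_pM2l ?mulr_gt0//.
by rewrite ltrXn2r ?nnegrE ?ltW.
Qed.

Lemma full_density'_ge0 x : 0 <= x < u -> 0 <= kappa' x.
Proof.
move=> /andP[]; rewrite le_eqVlt => /predU1P[<-|x0] xu; last first.
  by rewrite ltW// full_density'_gt0 ?x0.
rewrite divr_ge0 ?mulr_ge0 ?exprn_ge0 ?sqrtr_ge0 ?(ltW b0)//.
by rewrite exprS mul0r mulr0 subr0 !mulr_ge0 ?(ltW a0).
Qed.

Lemma full_density_increasing x y : 0 <= x -> x < y -> y <= u -> kappa x < kappa y.
Proof.
apply: (derive_gt0_increasing (F' := kappa')).
  by move=> z /andP[z0 _]; exact: full_density_derive.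
exact: full_density'_gt0.
Qed.

Lemma full_density_le x y : 0 <= x -> x <= y -> y <= u -> kappa x <= kappa y.
Proof.
move=> x0; rewrite le_eqVlt => /predU1P[->//|xy] yu.
by rewrite ltW// full_density_increasing.
Qed.

Lemma full_density0 : kappa 0 = 0.
Proof. by rewrite /full_density -(prednK k_gt0) exprS mul0r !mulr0 mul0r. Qed.

Let ckappa (x y : R) : 0 <= x -> {within `[x, y], continuous kappa}.
Proof.
move=> x0; apply: (is_derive_within_continuous (F' := kappa')) => z /andP[xz _].
by apply: full_density_derive; exact: le_trans xz.
Qed.

Let ckappa' (x y : R) : 0 <= x -> {within `[x, y], continuous kappa'}.
Proof.
move=> x0; apply: continuous_in_subspaceT => z /set_mem; rewrite /= in_itv/=.
move=> /andP[xz _]; have z0 := le_trans x0 xz.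
have [d [dz _]] : exists d, is_derive z 1 kappa' d.
  eexists; rewrite /full_density'; derive_rules.
  - by rewrite mulf_neq0 ?expf_neq0 ?gt_eqF ?S_gt0.
  - exact: f_gt0.
  - exact: df.
exact/differentiable_continuous/derivable1_diffP.
Qed.

Let m_kappa' : measurable_fun (`[0, u[%classic : set R) kappa'.
Proof.
apply: measurable_funS (subspace_continuous_measurable_fun _ (@ckappa' 0 u (lexx 0))).
- exact: measurable_itv.
- by apply: subset_itvl; rewrite bnd_simp.
- exact: measurable_itv.
Qed.

Let m_kappa : measurable_fun (`[0, u[%classic : set R) kappa.
Proof.
apply: measurable_funS (subspace_continuous_measurable_fun _ (@ckappa 0 u (lexx 0))).
- exact: measurable_itv.
- by apply: subset_itvl; rewrite bnd_simp.
- exact: measurable_itv.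
Qed.

Variable (m : R).
Hypotheses (u1 : u <= 1) (m0 : 0 <= m) (kappa_m : u < 1 -> kappa u <= m).

Definition plateau_density x := if x < u then kappa x else m.

Lemma plateau_admissible : admissible_density plateau_density.
Proof.
split.
- move=> x; rewrite in_itv/= /plateau_density => /andP[x0 _].
  by case: ifP => // _; exact: full_density_ge0.
- move=> x y; rewrite !in_itv/= /plateau_density => /andP[x0 x1] /andP[y0 y1] xy.
  have [xu|ux] := ltP x u; have [yu|uy] := ltP y u => //.
  + exact: full_density_le (ltW yu).
  + by apply: le_trans (kappa_m (le_lt_trans uy y1)); exact: full_density_le (ltW xu) _.
  + by have := lt_le_trans yu (le_trans ux xy); rewrite ltxx.
- move=> x; rewrite in_itv/= => /andP[x0 x1].
  have [xu|ux] := ltP x u.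
    have ck : kappa y @[y --> x^'+] --> kappa x.
      apply: cvg_at_right_filter.
      apply/differentiable_continuous/derivable1_diffP.
      by have [] := full_density_derive x0.
    rewrite /plateau_density xu; apply: cvg_trans ck; apply: near_eq_cvg.
    by near=> y; rewrite ifT//; near: y; exact: nbhs_right_lt.
  rewrite /plateau_density ltNge ux/=; apply: (@cvg_trans _ (cst m y @[y --> x^'+])).
    apply: near_eq_cvg; near=> y; rewrite ifF//; apply/negbTE; rewrite -leNgt.
    by rewrite (le_trans ux)//; near: y; exact: nbhs_right_ge.
  exact: cvg_cst.
Unshelve. all: by end_near. Qed.

Lemma plateau_integral x D : 0 <= x < 1 -> line D m u = (S u)^-1 ->
  (\int[mu]_(t in `]x, 1%R[) (plateau_density t)%:E =
   ((if (x < u)%R then (S x)^-1 else line D m x) - D)%:E)%E.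
Proof.
move=> /andP[x0 x1] lu; have [xu|ux] := ltP x u; last first.
  transitivity (\int[mu]_(t in `]x, 1%R[) m%:E)%E.
    apply: eq_integral => t /set_mem; rewrite /= in_itv/= => /andP[xt _].
    by rewrite /plateau_density ltNge (le_trans ux (ltW xt)).
  rewrite integral_cst_itv ?(ltW x1)//; congr EFin; rewrite /line; ring.
have -> : `]x, 1[%classic = `]x, u[%classic `|` `[u, 1[%classic :> set R.
  by rewrite -(@itv_bndbnd_setU _ _ _ (BLeft u))//= bnd_simp.
have xu0 t : `]x, u[%classic t -> 0 <= t < u.
  by rewrite /= in_itv/= => /andP[xt ->]; rewrite (le_trans x0 (ltW xt)).
have gE1 : {in `]x, u[%classic : set R,
    (fun t => (plateau_density t)%:E) =1 (fun t => (kappa t)%:E)}.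
  by move=> t /set_mem /xu0 /andP[_ tu]; rewrite /plateau_density tu.
have gE2 : {in `[u, 1[%classic : set R,
    (fun t => (plateau_density t)%:E) =1 (fun=> m%:E)}.
  move=> t /set_mem; rewrite /= in_itv/= => /andP[ut _].
  by rewrite /plateau_density ltNge ut.
have mk : measurable_fun (`]x, u[%classic : set R) kappa.
  apply: measurable_funS m_kappa; first exact: measurable_itv.
  by move=> t /xu0; rewrite /= in_itv.
rewrite ge0_integral_setU//=.
- have -> : (\int[mu]_(t in `]x, u[) (plateau_density t)%:E =
      \int[mu]_(t in `]x, u[) (kappa t)%:E)%E.
    by apply: eq_integral => t tu; rewrite gE1.
  have -> : (\int[mu]_(t in `[u, 1%R[) (plateau_density t)%:E =
      \int[mu]_(t in `[u, 1%R[) m%:E)%E.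
    by apply: eq_integral => t tu; rewrite gE2.
  rewrite integral_cst_itv//.
  have -> : (\int[mu]_(t in `]x, u[) (kappa t)%:E = (- (S u)^-1 - - (S x)^-1)%:E)%E.
    rewrite -(@integral_itv_bndoo _ x u _ true false); last exact/measurable_EFinP.
    apply: (integral_derive (F := fun y => - (S y)^-1)) => //.
      by move=> t /andP[xt _]; apply: inv_sqrt_derive; exact: le_trans xt.
    exact: ckappa.
  by rewrite -EFinD -lu /line; congr EFin; ring.
- apply/measurable_EFinP.
  apply: measurable_funS (admissible_measurable plateau_admissible).
    exact: measurable_itv.
  move=> t [/xu0 /andP[t0 tu]|]; rewrite /= !in_itv/=.
    by rewrite t0 (lt_le_trans tu).
  by move=> /andP[ut ->]; rewrite (le_trans (ltW u0)).
- move=> t [/xu0 /andP[t0 tu]|].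
    by rewrite lee_fin /plateau_density tu full_density_ge0.
  by rewrite /= in_itv/= => /andP[ut _]; rewrite lee_fin /plateau_density ltNge ut.
- by apply/disj_setPS => t [] /xu0 /andP[_ tu]; rewrite /= in_itv/= leNgt tu.
Qed.

Let integral_kappa' y : 0 <= y <= u ->
  (\int[mu]_(x in `[0%R, y]) (kappa' x)%:E = (kappa y)%:E)%E.
Proof.
move=> /andP[]; rewrite le_eqVlt => /predU1P[<-|y0] yu.
  by rewrite set_itv1 integral_set1 full_density0.
have dk (x : R) : 0 <= x <= y -> is_derive x 1 kappa (kappa' x).
  by move=> /andP[x0 _]; exact: full_density_derive.
by rewrite (integral_derive dk y0 (@ckappa' 0 y (lexx 0))) full_density0 subr0.
Qed.

(** The measure has the density [full_density'] on [0, u[ and an atom at [u] for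
the jump to the plateau. *)
Lemma plateau_cdf : exists2 rho : borel_measure R,
  has_cdf rho plateau_density &
  u = 1 -> rho `<< mu.
Proof.
(* For [u = 1] the density has no jump inside [0, 1[. *)
pose c := if u < 1 then m - kappa u else 0.
have c0 : 0 <= c by rewrite /c; case: ifP => // /kappa_m; rewrite subr_ge0.
have mu0 : measurable (`[0, u[%classic : set R) by exact: measurable_itv.
have kp0 (x : R) : `[0, u[%classic x -> 0 <= kappa' x.
  by rewrite /= in_itv/=; exact: full_density'_ge0.
have [rho rhoE] := density_atom_measure u mu0 m_kappa' kp0 c0.
exists rho; last first.
  move=> uE; apply/null_content_dominatesP => A mA A0.
  rewrite rhoE// /c uE ltxx mul0e adde0 -uE; apply: null_set_integral.
  - exact: measurableI.
  - by apply/measurable_EFinP; apply: measurable_funS m_kappa'.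
  - by apply: subset_measure0 A0 => //; exact: measurableI.
split.
  rewrite rhoE; last by apply: measurableC; exact: measurable_itv.
  rewrite (_ : _ `&` _ = set0); last first.
    apply/seteqP; split=> x //= [+]; rewrite !in_itv/= => /negP x01 /andP[x0 xu].
    by move: x01; rewrite x0 (lt_le_trans xu).
  rewrite integral_set0 add0e /c; case: ifP => [ul1|_]; last by rewrite mul0e.
  rewrite diracE memNset ?mule0// => /=; apply.
  by rewrite in_itv/= (ltW u0).
move=> x; rewrite in_itv/= => /andP[x0 x1].
rewrite rhoE; last exact: measurable_itv.
have [xu|ux] := ltP x u.
  rewrite (_ : _ `&` _ = `[0, x]%classic); last first.
    apply/setIidPl => t /=; rewrite !in_itv/= => /andP[-> tx].
    exact: le_lt_trans tx xu.
  rewrite integral_kappa' ?x0 ?ltW// diracE memNset ?mule0 ?adde0.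
    by rewrite /plateau_density xu.
  by rewrite /= in_itv/= (leNgt u) xu andbF.
have ul1 := le_lt_trans ux x1.
rewrite (_ : _ `&` _ = `[0, u[%classic); last first.
  apply/setIidPr => t /=; rewrite !in_itv/= => /andP[-> tu].
  exact: le_trans (ltW tu) ux.
rewrite integral_itv_bndo_bndc; last exact/measurable_EFinP.
rewrite integral_kappa' ?lexx ?(ltW u0)// diracE mem_set; last first.
  by rewrite /= in_itv/= (ltW u0).
by rewrite mule1 /c ul1 -EFinD /plateau_density ltNge ux/= addrC subrK.
Qed.
End FullDensity.

(** * Constant densities *)

Section ConstantDensity.
Context {R : realType}.
Variable (m : R).
Hypothesis m0 : 0 <= m.

Lemma cst_admissible : admissible_density (fun=> m : R).
Proof. by split => // x _; exact: cvg_cst. Qed.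

Lemma cst_cdf : exists2 rho : borel_measure R, has_cdf rho (fun=> m) &
  forall A : set (measurableTypeR R), measurable A ->
    rho A = (m%:E * \d_(0%R : measurableTypeR R) A)%E.
Proof.
have g0 (x : R) : set0 x -> 0 <= (fun=> 0 : R) x by [].
have [||rho rhoE] := @density_atom_measure R set0 (fun=> 0) m 0 _ _ g0 m0.
- exact: measurable0.
- exact: measurable_cst.
have {}rhoE (A : set (measurableTypeR R)) : measurable A ->
    rho A = (m%:E * \d_(0%R : measurableTypeR R) A)%E.
  by move=> mA; rewrite rhoE// setI0 integral_set0 add0e.
exists rho => //; split.
  rewrite rhoE; last by apply: measurableC; exact: measurable_itv.
  by rewrite diracE memNset ?mule0// => /=; apply; rewrite in_itv/= lexx ltr01.
move=> x; rewrite in_itv/= => /andP[x0 _].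
rewrite rhoE; last exact: measurable_itv.
by rewrite diracE mem_set ?mule1//= in_itv/= lexx.
Qed.

Lemma atom_support (rho : borel_measure R) :
  (forall A : set (measurableTypeR R), measurable A ->
    rho A = (m%:E * \d_(0%R : measurableTypeR R) A)%E) ->
  msupport01 rho = if 0 < m then [set 0] else set0.
Proof.
move=> rhoE; case: ifPn => [mpos|].
  apply/seteqP; split => x /=.
    move=> [_ supp]; apply: contrapT => x0.
    have oU : open (~` [set (0 : R)]).
      by rewrite openC; exact/accessible_closed_set1/hausdorff_accessible/Rhausdorff.
    have := supp _ oU x0; rewrite rhoE; last exact: open_measurable.
    by rewrite diracE memNset ?mule0 ?ltxx// => /=; apply.
  move=> ->; split; first by rewrite in_itv/= lexx ltr01.
  move=> U oU U0; rewrite rhoE; last exact: open_measurable.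
  by rewrite diracE mem_set// mule1 lte_fin.
rewrite lt_neqAle m0 andbT negbK => /eqP m00.
apply/seteqP; split => x //= -[_ supp].
have := supp setT openT I; rewrite rhoE; last exact: measurableT.
by rewrite -m00 mul0e ltxx.
Qed.
End ConstantDensity.

(** * Parisi measures of the phases *)

Section Phases.
Context {R : realType}.
Variables (k : nat) (l : R).
Hypotheses (l0 : 0 <= l) (l1 : l < 1).
Local Notation xi := (mixture k.+3 l).
Local Notation a := (hess_a l).
Local Notation b := (hess_b k l).

Lemma residual_signs (D m u p q : R) : 0 < D -> 0 < m ->
  neg_pos_neg (gap k a b D m) u p q ->
  [/\ forall x, u <= x < p -> residual k a b D m x <= 0,
      forall x, p < x < q -> 0 <= residual k a b D m x &
      forall x, q < x < 1 -> residual k a b D m x <= 0].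
Proof.
move=> D0 m0 [[/andP[up pq] q1] n1 n2 n3]; split => x /andP[h1 h2].
- rewrite residualE//; last by rewrite (le_trans (ltW h2))// (le_trans pq).
  by rewrite mulr_le0_ge0 ?invr_ge0 ?sqr_ge0// n1 ?h1.
- rewrite residualE//; last by rewrite (le_trans (ltW h2)).
  by rewrite mulr_ge0 ?invr_ge0 ?sqr_ge0// n2 ?h1.
- rewrite residualE//; last exact: ltW.
  by rewrite mulr_le0_ge0 ?invr_ge0 ?sqr_ge0// n3 ?h1 ?ltW.
Qed.

(** The case [u = 0] of the certificate. *)
Lemma linear_parisi (z : R) : 0 < z -> log_ratio z = (mix_slope k l 1)^-1 ->
  2 * l * z <= (k%:R + 3) * (1 - l) ->
  exists (nu : borel_measure R) (m D : R),
    [/\ 0 < m, is_parisi_measure xi nu & has_form nu (fun=> m) D].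
Proof.
move=> z0 zE zle.
have [D [m [D0 m0 VE WE gap0]]] := linear_certificate l1 z0 zE zle.
have u01 : 0 <= (0 : R) <= 1 by rewrite lexx ler01.
have [p [q npn]] := gap_signs (hess_b_gt0 k l1) D0 m0 u01 gap0.
have [n1 n2 n3] := residual_signs D0 m0 npn.
have [[/andP[up pq] q1] _ _ _] := npn.
have u01' : 0 <= (0 : R) < 1 by rewrite lexx ltr01.
have [ih0 ih1] := residual_integrals D0 m0 (mixture_derive k l) (mix_slope_derive k l) u01' VE WE.
have [||nu nuP nuF] := @mixture_parisi R k l l0 (ltW l1) (fun=> m)
  (line D m) D m 0 p q (cst_admissible (ltW m0)) D0 _ (lexx 0) up pq q1
  (fun _ _ => erefl) _ n1 n2 n3 ih0 ih1.
- move=> x /andP[x0 x1]; rewrite integral_cst_itv ?(ltW x1)//.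
  by congr EFin; rewrite /line; ring.
- by move=> x /andP[x0 /(le_lt_trans x0)]; rewrite ltxx.
by exists nu, m, D.
Qed.

(** The case [u > 0]; for [u = 1] the affine part is empty and only its value
[D] at 1 matters, which is why the moment equations are conditional. *)
Lemma plateau_parisi (D m u : R) : (0 < k)%N -> 0 < l -> 0 < u <= 1 ->
  0 < D -> 0 < m ->
  b * (k%:R + 3) * u ^+ k.+1 <= 2 * k%:R * a ->
  line D m u = (Num.sqrt (hess k a b u))^-1 ->
  (u < 1 -> [/\ full_density k a b u <= m,
     moment0 D m (mix_slope k l) 1 = moment0 D m (mix_slope k l) u &
     moment1 D m xi (mix_slope k l) 1 = moment1 D m xi (mix_slope k l) u]) ->
  exists2 nu : borel_measure R, is_parisi_measure xi nu &
    has_form nu (plateau_density k a b u m) D.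
Proof.
move=> k0 lpos /andP[u0 u1] D0 m0 convex_u lu kink.
have a0 : 0 < a by rewrite /hess_a mulr_gt0.
have b0 := hess_b_gt0 k l1.
have kappa_m : u < 1 -> full_density k a b u <= m by move=> /kink[].
have adm := plateau_admissible k0 a0 b0 convex_u (ltW m0) kappa_m.
have int := plateau_integral k0 a0 b0 u0 convex_u u1 (ltW m0) kappa_m.
pose psi x := if x < u then (Num.sqrt (hess k a b x))^-1 else line D m x.
have hpos x : 0 <= x -> 0 < hess k a b x.
  by move=> x0; rewrite ltr_pwDl// mulr_ge0 ?exprn_ge0// ltW.
have h0 x : 0 <= x < u -> hess k a b x - psi x ^- 2 = 0.
  move=> /andP[x0 xu]; rewrite /psi xu exprVn invrK sqr_sqrtr ?subrr//.
  exact/ltW/hpos.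
have lin x : u <= x < 1 -> psi x = line D m x.
  by move=> /andP[ux _]; rewrite /psi ltNge ux.
have [p [q [up pq q1 [n1 n2 n3] [ih0 ih1]]]] : exists p q, [/\ u <= p, p <= q, q <= 1,
    [/\ forall x, u <= x < p -> residual k a b D m x <= 0,
      forall x, p < x < q -> 0 <= residual k a b D m x &
      forall x, q < x < 1 -> residual k a b D m x <= 0] &
    (\int[lebesgue_measure]_(x in `[u, 1%R[) (residual k a b D m x)%:E = 0)%E /\
    (\int[lebesgue_measure]_(x in `[u, 1%R[)
       (residual k a b D m x * (1 - x))%:E = 0)%E].
  move: u1; rewrite le_eqVlt => /predU1P[uE|ul1].
    exists 1, 1; rewrite uE; split => //; last first.
      by rewrite set_itv_ge ?bnd_simp ?ltxx// !integral_set0.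
    by split=> x /andP[h1]; [move=> /(le_lt_trans h1)|move=> /(lt_trans h1)|
      move=> /(lt_trans h1)]; rewrite ltxx.
  have [_ VE WE] := kink ul1.
  have u01 : 0 <= u < 1 by rewrite ltW.
  have u01' : 0 <= u <= 1 by rewrite !ltW.
  have gap0 : gap k a b D m u <= 0.
    have hu := hpos _ (ltW u0).
    by rewrite /gap lu exprVn sqr_sqrtr ?(ltW hu)// mulfV ?subrr// gt_eqF.
  have [p [q npn]] := gap_signs b0 D0 m0 u01' gap0.
  have [[/andP[up pq] q1] _ _ _] := npn.
  exists p, q; split => //; first exact: residual_signs npn.
  exact: (residual_integrals D0 m0 (mixture_derive k l) (mix_slope_derive k l) u01 VE WE).
apply: (@mixture_parisi R k l l0 (ltW l1) _ psi D m u p q adm D0 _ (ltW u0) up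
  pq q1 lin h0 n1 n2 n3 ih0 ih1).
by move=> x x01; exact: int lu.
Qed.
End Phases.

(** * The two thresholds *)

Section Thresholds.
Context {R : realType}.
Variables (k : nat) (l : R).
Local Notation N := ((k%:R + 3) ^+ 2 * (k%:R + 2) : R).

Let k0 : 0 <= k%:R :> R. Proof. exact: ler0n. Qed.

Let natE3 : k.+3%:R = k%:R + 3 :> R. Proof. by ring. Qed.

Let lambda_1F_FE : lambda_1F_F R k.+3 = N / (N + 4 * k%:R).
Proof.
rewrite /lambda_1F_F natE3; congr (_ / _); ring.
Qed.

Let den0 : 0 < N + 4 * k%:R.
Proof.
rewrite ltr_pwDl ?mulr_ge0// mulr_gt0 ?exprn_gt0//; have := k0; lra.
Qed.

(** The threshold is the value of lambda at which the inflexion point of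
[f^(-1/2)] is 1. *)
Lemma lt_lambda_1F_F : (l < lambda_1F_F R k.+3) =
  (2 * k%:R * hess_a l < hess_b k l * (k%:R + 3)).
Proof.
rewrite lambda_1F_FE ltr_pdivlMr// -subr_gt0 -[RHS]subr_gt0 /hess_a /hess_b.
by congr (0 < _); ring.
Qed.

Lemma lambda_1F_F_le1 : lambda_1F_F R k.+3 <= 1.
Proof. by rewrite lambda_1F_FE ler_pdivrMr// mul1r lerDl mulr_ge0. Qed.

Lemma lambda_1F_F_gt0 : 0 < lambda_1F_F R k.+3.
Proof.
rewrite lambda_1F_FE divr_gt0// mulr_gt0 ?exprn_gt0//; have := k0; lra.
Qed.

(** The inequality is the negation of the one defining the set whose infimum is
[lambda_1_1F]; [lambda = 1] belongs to that set. *)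
Lemma below_lambda_1_1F : 0 <= l <= 1 -> l < lambda_1_1F R k.+3 ->
  l < 1 /\ 2 * l * zeta k.+3 l < (k%:R + 3) * (1 - l).
Proof.
move=> l01; rewrite /lambda_1_1F; set A := [set _ | _] => lA.
have lbA : has_lbound A by exists 0 => x [/andP[x0 _] _].
have notA x : A x -> x <= l -> False.
  by move=> Ax xl; have := lt_le_trans lA (ge_inf lbA Ax); rewrite ltNge xl.
have A1 : A 1.
  by rewrite /A /= lexx ler01; split=> //; rewrite /zeta eqxx !mulr0 subrr mulr0.
split.
  by rewrite ltNge; apply/negP => /(notA _ A1).
rewrite ltNge -natE3; apply/negP => h.
by apply: (notA l) => //; split.
Qed.
End Thresholds.

(** * The phase diagram *)

Section Conclusions.
Context {R : realType}.
Variables (k : nat) (l : R).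
Local Notation xi := (mixture k.+3 l).
Local Notation a := (hess_a l).
Local Notation b := (hess_b k l).

Lemma cst_data (nu : borel_measure R) (m D : R) : 0 <= m ->
  is_parisi_measure xi nu -> has_form nu (fun=> m) D ->
  exists2 rho, parisi_data xi nu (fun=> m) D rho &
    msupport01 rho = if 0 < m then [set 0] else set0.
Proof.
move=> m0 nuP nuF; have [rho cdf rhoE] := cst_cdf m0.
by exists rho => //; exact: atom_support.
Qed.

(** The same constant density is 1-RSB and 1-FRSB: its derivative measure is an
atom at 0, and it is a plateau filling [0, 1[. *)
Lemma linear_1RSB (z : R) : 0 <= l < 1 -> 0 < z ->
  log_ratio z = (mix_slope k l 1)^-1 -> 2 * l * z <= (k%:R + 3) * (1 - l) ->
  kRSB 1 xi /\ one_FRSB xi.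
Proof.
move=> /andP[l0 l1] z0 zE zle.
have [nu [m [D [m0 nuP nuF]]]] := linear_parisi l0 l1 z0 zE zle.
have [rho data supp] := cst_data (ltW m0) nuP nuF.
split; exists nu, (fun=> m), D, rho; split => //.
  by rewrite supp m0 card_set1.
(* With [q = 1] the second piece is empty, so any increasing [w] will do. *)
exists 1, m, id; split => //; left => A mA.
have [_ _ ->] := nuF; last exact: mA.
congr (_ + _)%E; apply: eq_integral => x /set_mem[_ x01].
rewrite !indicE (mem_set x01) mulr1 memNset ?mulr0 ?addr0//=.
by rewrite in_itv/= => /andP[/le_lt_trans h /h]; rewrite ltxx.
Qed.

(** For [s = 3], where [k = 0], the function [f^(-1/2)] is convex. *)
Lemma convex_degree (c d u : R) : 0 < c -> 0 < u ->
  c * (k%:R + 3) * u ^+ k.+1 <= 2 * k%:R * d -> (0 < k)%N.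
Proof.
move=> c0 u0; case: k => //; rewrite mulr0 mul0r add0r expr1 leNgt.
by rewrite !mulr_gt0.
Qed.

(** For [lambda = 0], [f] vanishes at 0 and only the solution with [u = 0] makes
sense; otherwise [tangent_dichotomy] provides one of the two solutions. *)
Lemma one_FRSB_phase : 0 <= l < lambda_1F_F R k.+3 -> one_FRSB xi.
Proof.
move=> /andP[l0 lF]; have l1 := lt_le_trans lF (lambda_1F_F_le1 k).
have l01 : 0 <= l < 1 by rewrite l0.
move: (l0); rewrite le_eqVlt => /predU1P[lz|lpos].
  have [z0 zE] := zetaP k l1.
  have zle : 2 * l * zeta k.+3 l <= (k%:R + 3) * (1 - l).
    by rewrite -lz mulr0 mul0r subr0 mulr1 addr_ge0.
  by have [_] := linear_1RSB l01 z0 zE zle.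
have convex1 : 2 * k%:R * a < b * (k%:R + 3) by rewrite -lt_lambda_1F_F.
have [[z [z0 zE zle]]|[u [u01 Fu convex_u]]] := tangent_dichotomy l0 l1 lpos convex1.
  by have [_] := linear_1RSB l01 z0 zE zle.
have /andP[u0 u1] := u01; have u01' : 0 <= u < 1 by rewrite ltW.
set D := tangent_D k l u; set m := tangent_m k l u.
have D0 : 0 < D by exact: tangent_D_gt0.
have m0 : 0 < m by exact: tangent_m_gt0.
have a0 : 0 < a by rewrite /hess_a mulr_gt0.
have b0 := hess_b_gt0 k l1.
have k0 : (0 < k)%N.
  exact: convex_degree b0 u0 convex_u.
have lu : line D m u = (Num.sqrt (hess k a b u))^-1 by exact: tangent_line.
have hu : 0 < hess k a b u by rewrite ltr_pwDl// mulr_ge0 ?exprn_ge0// ltW.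
have su : 0 < Num.sqrt (hess k a b u) by rewrite sqrtr_gt0.
have kappa_m : full_density k a b u <= m.
  have := tangent_slope_le0 l1 lpos u01' Fu.
  rewrite -/D -/m /gap_slope lu subr_le0 -[X in _ <= _ * X](sqr_sqrtr (ltW hu)) => slope.
  rewrite /full_density ler_pdivrMr ?mulr_gt0 ?exprn_gt0//.
  have cube (s : R) : m * (2 * s ^+ 3) = 2 * m * s ^+ 2 * s by ring.
  by rewrite cube -ler_pdivrMr.
have VE : moment0 D m (mix_slope k l) 1 = moment0 D m (mix_slope k l) u.
  exact: tangent_moment0.
have WE : moment1 D m xi (mix_slope k l) 1 = moment1 D m xi (mix_slope k l) u.
  by apply/eqP; rewrite -subr_eq0 tangent_moment1// Fu.
have u01c : 0 < u <= 1 by rewrite u0 ltW.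
have [nu nuP nuF] := plateau_parisi l0 l1 k0 lpos u01c D0 m0 convex_u lu
  (fun _ => And3 kappa_m VE WE).
have [rho cdf _] := plateau_cdf k0 a0 b0 u0 convex_u (ltW u1) (fun _ => kappa_m).
exists nu, (plateau_density k a b u m), D, rho; split => //.
(* Past [q = u] the term [m + x] continues the curved part increasingly. *)
pose w x := if x < u then full_density k a b x else m + x.
exists u, m, w; split => //.
  move=> x y; rewrite !in_itv/= /w => /andP[x0 _] /andP[y0 _] xy.
  have inc := @full_density_increasing R k a b u k0 a0 b0 convex_u.
  have [xu|ux] := ltP x u; have [yu|uy] := ltP y u.
  - by apply: inc => //; exact: ltW.
  - apply: (@lt_le_trans _ _ (full_density k a b u)); first exact: inc.
    by rewrite (le_trans kappa_m)// lerDl.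
  - by have := lt_trans (le_lt_trans ux xy) yu; rewrite ltxx.
  - by rewrite ltrD2l.
right => A mA; have [_ _ ->] := nuF; last exact: mA.
congr (_ + _)%E; apply: eq_integral => x /set_mem[_]; rewrite /= in_itv/=.
move=> /andP[x0 x1]; rewrite !indicE !mem_setE !in_itv/= x0 x1 andbT/= /w /plateau_density.
by have [xu|ux] := ltP x u; rewrite ?mulr1 ?mulr0 ?addr0 ?add0r.
Qed.

(** From the threshold on, [f^(-1/2)] is concave on all of [0, 1]: the certificate
holds with [u = 1], where the residual is 0 everywhere. *)
Lemma FRSB_phase : lambda_1F_F R k.+3 <= l < 1 -> FRSB xi.
Proof.
move=> /andP[lF l1]; have lpos := lt_le_trans (lambda_1F_F_gt0 k) lF.
have l0 := ltW lpos.
have a0 : 0 < a by rewrite /hess_a mulr_gt0.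
have b0 := hess_b_gt0 k l1.
have k3 : 0 < k%:R + 3 :> R by rewrite ltr_wpDl.
have convex_u : b * (k%:R + 3) * 1 ^+ k.+1 <= 2 * k%:R * a.
  by rewrite expr1n mulr1 leNgt -lt_lambda_1F_F -leNgt.
have k0 : (0 < k)%N.
  exact: convex_degree b0 ltr01 convex_u.
have u01 : 0 < (1 : R) <= 1 by rewrite ltr01 lexx.
have h1 : 0 < hess k a b 1 by rewrite /hess addr_gt0// expr1n mulr1.
pose D := (Num.sqrt (hess k a b 1))^-1.
have D0 : 0 < D by rewrite invr_gt0 sqrtr_gt0.
have lu : line D 1 1 = (Num.sqrt (hess k a b 1))^-1.
  by rewrite /line subrr mulr0 addr0.
have no1 (P : Prop) : (1 : R) < 1 -> P by rewrite ltxx.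
have [nu nuP nuF] := plateau_parisi l0 l1 k0 lpos u01 D0 ltr01 convex_u lu (no1 _).
have [rho cdf /(_ erefl) rho_ac] := plateau_cdf k0 a0 b0 ltr01 convex_u (lexx 1)
  (no1 (full_density k a b 1 <= 1)).
exists nu, (plateau_density k a b 1 1), D, rho; split => //; split.
  exact: rho_ac.
have h01 : (2^-1 : R) \in `[0, 1[ by rewrite in_itv/=; lra.
apply: (@lt_le_trans _ _ (rho `[0, 2^-1]%classic)); last first.
  apply: le_measure; rewrite ?inE; try exact: measurable_itv.
  by apply: subset_itvl; rewrite bnd_simp; lra.
have [_ ->//] := cdf; rewrite /plateau_density ifT; last by lra.
rewrite lte_fin -(@full_density0 R k a b k0).
by apply: (full_density_increasing k0 a0 b0 convex_u); lra.
Qed.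

(** Here [f = 2], so a constant profile makes the residual vanish identically. *)
Lemma RS_phase : l = 1 -> kRSB 0 xi.
Proof.
move=> lE; have s2 : 0 < Num.sqrt 2 :> R by rewrite sqrtr_gt0.
have s22 : Num.sqrt 2 ^+ 2 = 2 :> R by rewrite sqr_sqrtr.
have res0 x : residual k a b (Num.sqrt 2)^-1 0 x = 0.
  rewrite /residual /hess /line /hess_a /hess_b lE subrr !mulr0 mul0r !addr0 mul0r addr0.
  by rewrite exprVn invrK s22 mulr1 subrr.
have [l0' l1'] : 0 <= l /\ l <= 1 by rewrite lE ler01 lexx.
have [] := @mixture_parisi R k l l0' l1' (fun=> 0) (fun=> (Num.sqrt 2)^-1)
  (Num.sqrt 2)^-1 0 0 0 0 (cst_admissible (lexx 0)) _ _
  (lexx 0) (lexx 0) (lexx 0) ler01.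
- by rewrite invr_gt0.
- by move=> x _; rewrite integral0 subrr.
- by move=> x _; rewrite /line mul0r addr0.
- by move=> x /andP[x0 /(le_lt_trans x0)]; rewrite ltxx.
- by move=> x _; rewrite res0.
- by move=> x _; rewrite res0.
- by move=> x _; rewrite res0.
- by apply: integral0_eq => x _; rewrite res0.
- by apply: integral0_eq => x _; rewrite res0 mul0r.
move=> nu nuP nuF; have [rho data supp] := cst_data (lexx 0) nuP nuF.
exists nu, (fun=> 0), (Num.sqrt 2)^-1, rho; split => //.
by rewrite supp ltxx II0 card_eq0 eqxx.
Qed.
End Conclusions.

Theorem theorem1 (R : realType) (s : nat) (lambda : R)
    (hs : (2 < s)%N) (hlambda : 0 <= lambda <= 1) :
  [/\ 0 <= lambda < lambda_1_1F R s -> kRSB 1 (mixture s lambda),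
      lambda_1_1F R s <= lambda < lambda_1F_F R s ->
        one_FRSB (mixture s lambda),
      lambda_1F_F R s <= lambda < 1 -> FRSB (mixture s lambda) &
      lambda = 1 -> kRSB 0 (mixture s lambda)].
Proof.
case: s hs => [|[|[|k]]] // _; have /andP[l0 _] := hlambda; split.
- move=> /andP[_ /(below_lambda_1_1F hlambda)[l1 zlt]].
  have [z0 zE] := zetaP k l1.
  have l01 : 0 <= lambda < 1 by rewrite l0.
  by have [] := linear_1RSB l01 z0 zE (ltW zlt).
- by move=> /andP[_ lF]; apply: one_FRSB_phase; rewrite l0.
- exact: FRSB_phase.
- exact: RS_phase.
Qed.
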